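(* For every $\Phi\in\operatorname{Aut}(F_2)$ the quaternionic Nielsen map $F_\Phi:\mathrm{SU}(2)^2\to\mathrm{SU}(2)^2$ preserves the product Haar measure $m\times m$. If $A=\mathrm R(\Phi)$, then $$F_\Phi^*\Omega=(\det A)\,\Omega .$$ In particular, every quaternionic lift of a matrix in $\mathrm{SL}(2,\mathbb Z)$ is orientation preserving and volume preserving.
   Context: $F_2=\langle x,y\rangle$ is the free group. For $\Phi\in\operatorname{Aut}(F_2)$, $F_\Phi(q_1,q_2)=(\Phi(x)(q_1,q_2),\Phi(y)(q_1,q_2))$, where $w(q_1,q_2)$ denotes substitution of $q_1$ for $x$ and $q_2$ for $y$ in a word $w$. The row exponent matrix $\mathrm R(\Phi)\in\mathrm{GL}(2,\mathbb Z)$ has first row the exponent sums (in $x$ and in $y$) of $\Phi(x)$ and second row those of $\Phi(y)$; a quaternionic lift of $A$ is a map $F_\Phi$ with $\mathrm R(\Phi)=A$. $m$ is normalized Haar measure on $\mathrm{SU}(2)$, $\nu$ is the bi-invariant Riemannian volume form on $\mathrm{SU}(2)$, and $\Omega=\pi_1^*\nu\wedge\pi_2^*\nu$, where $\pi_1,\pi_2:\mathrm{SU}(2)^2\to\mathrm{SU}(2)$ are the projections. *)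

(* Defs.v *)
From HB Require Import structures.
From mathcomp Require Import all_boot all_order all_fingroup all_algebra.
From mathcomp Require Import spectral sesquilinear complex.
From mathcomp Require Import all_classical all_reals all_analysis.

Set Implicit Arguments.
Unset Strict Implicit.
Unset Printing Implicit Defensive.

Import Order.TTheory GRing.Theory Num.Theory.
Import numFieldNormedType.Exports.

Local Open Scope classical_set_scope.
Local Open Scope ring_scope.

(* A letter (i, b) is the generator number i if b = false, and its inverse if
   b = true. *)
Definition letter : Type := ('I_2 * bool)%type.
HB.instance Definition _ := Choice.on letter.

Definition linv (a : letter) : letter := (a.1, ~~ a.2).
Arguments linv : simpl never.

Definition reduced (w : seq letter) : bool := sorted (fun a b => b != linv a) w.

(* Elements of the free group of rank 2 are the reduced words. *)
Record F2 := FreeWord { word :> seq letter; word_reduced : reduced word }.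
HB.instance Definition _ := [isSub for word].
HB.instance Definition _ := [Choice of F2 by <:].

Definition cons_letter (a : letter) (w : seq letter) : seq letter :=
  if w is b :: w' then if b == linv a then w' else a :: w else [:: a].

(* The reduced form of the concatenation u ++ w, for w reduced. *)
Definition mulw (u w : seq letter) : seq letter := foldr cons_letter w u.

Definition invw (u : seq letter) : seq letter := rev (map linv u).

Lemma linvK : involutive linv.
Proof. by case=> i b; rewrite /linv /= negbK. Qed.

Lemma linv_neq a : a != linv a.
Proof. by case: a => i b; rewrite /linv /=; apply/eqP => -[]; case: b. Qed.

Lemma reduced_tail a w : reduced (a :: w) -> reduced w.
Proof. exact: path_sorted. Qed.

Lemma reduced_cons_letter a w : reduced w -> reduced (cons_letter a w).
Proof.
case: w => [//|b w] /= rw; case: ifPn => [_|nb]; first exact: reduced_tail rw.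
by rewrite /reduced /= nb.
Qed.

Lemma cons_letterK a w : reduced w ->
  cons_letter (linv a) (cons_letter a w) = w.
Proof.
case: w => [_|b w] /=; first by rewrite linvK eqxx.
case: (eqVneq b (linv a)) => [->|nb] rw; last by rewrite /= linvK eqxx.
by case: w rw => [//|c w] /=; rewrite /reduced /= => /andP[/negPf-> _].
Qed.

Lemma reduced_mulw u w : reduced w -> reduced (mulw u w).
Proof. by move=> rw; elim: u => //= a u; apply: reduced_cons_letter. Qed.

Lemma mulw_cons_letter a u w : reduced u -> reduced w ->
  mulw (cons_letter a u) w = cons_letter a (mulw u w).
Proof.
case: u => [//|b u] /= ru rw; case: (eqVneq b (linv a)) => [->|//].
by have /= := cons_letterK (linv a) (reduced_mulw u rw); rewrite linvK.
Qed.

Lemma mulwA u v w : reduced v -> reduced w ->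
  mulw u (mulw v w) = mulw (mulw u v) w.
Proof.
move=> rv rw; elim: u => //= a u ->.
by rewrite mulw_cons_letter ?reduced_mulw.
Qed.

Lemma mulw_nil u : reduced u -> mulw u [::] = u.
Proof.
elim: u => //= a u IH rau; rewrite IH; last exact: reduced_tail rau.
case: u rau {IH} => //= b u; rewrite /reduced /=.
by move=> /andP[/negPf-> _].
Qed.

Lemma mulw_cat u v w : mulw (u ++ v) w = mulw u (mulw v w).
Proof. exact: foldr_cat. Qed.

Lemma mulw_invl u w : reduced w -> mulw (invw u) (mulw u w) = w.
Proof.
elim: u w => //= a u IH w rw.
rewrite /invw /= rev_cons -cats1 mulw_cat /= cons_letterK ?IH //.
exact: reduced_mulw.
Qed.

Lemma reduced_invw u : reduced u -> reduced (invw u).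
Proof.
rewrite /reduced /invw rev_sorted sorted_map.
rewrite (@eq_sorted _ _ (fun a b => b != linv a)) // => a b /=.
by rewrite linvK eq_sym.
Qed.

Definition mulF2 (u w : F2) : F2 := FreeWord (reduced_mulw u (word_reduced w)).
Definition invF2 (u : F2) : F2 := FreeWord (reduced_invw (word_reduced u)).
Definition oneF2 : F2 := @FreeWord [::] isT.

Lemma mulF2A : associative mulF2.
Proof. by move=> u v w; apply: val_inj; apply: mulwA; apply: word_reduced. Qed.

Lemma mul1F2 : left_id oneF2 mulF2.
Proof. by move=> u; apply: val_inj. Qed.

Lemma mulF21 : right_id oneF2 mulF2.
Proof. by move=> u; apply: val_inj; apply: mulw_nil; apply: word_reduced. Qed.

Lemma mulVF2 : left_inverse oneF2 invF2 mulF2.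
Proof.
move=> u; apply: val_inj; rewrite /= -{2}[word u](mulw_nil (word_reduced u)).
exact: mulw_invl.
Qed.

Lemma invF2K : involutive invF2.
Proof.
move=> u; apply: val_inj; rewrite /= /invw map_rev revK -map_comp.
by rewrite (eq_map (g := id)) ?map_id // => a; apply: linvK.
Qed.

Lemma mulF2V : right_inverse oneF2 invF2 mulF2.
Proof. by move=> u; rewrite -{1}[u]invF2K mulVF2. Qed.

HB.instance Definition _ :=
  isGroup.Build F2 mulF2A mul1F2 mulF21 mulVF2 mulF2V.

Definition gen (i : 'I_2) : F2 := @FreeWord [:: (i, false)] isT.

Record GroupAut (G : groupType) := MkGroupAut {
  aut_fun :> {multiplicative G -> G};
  aut_bij : bijective aut_fun }.

(* The substitution w(q1, q2). *)
Definition subst (G : groupType) (q1 q2 : G) (w : F2) : G :=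
  (\prod_(a <- word w)
     let q := if a.1 == ord0 then q1 else q2 in if a.2 then q^-1 else q)%g.

Definition nielsen_map (G : groupType) (Phi : GroupAut F2) (q : G * G) :
    G * G :=
  (subst q.1 q.2 (Phi (gen ord0)), subst q.1 q.2 (Phi (gen ord_max))).

Definition expsum (j : 'I_2) (w : F2) : int :=
  \sum_(a <- word w | a.1 == j) (-1) ^+ a.2.

Definition row_exponent (Phi : GroupAut F2) : 'M[int]_2 :=
  \matrix_(i, j) expsum j (Phi (gen i)).

Section SU2.
Context (R : realType).
Local Open Scope sesquilinear_scope.

Record SU2 := MkSU2 {
  su2mx :> 'M[R[i]]_2;
  su2mxP : (su2mx \is unitarymx) && (\det su2mx == 1) }.
HB.instance Definition _ := [isSub for su2mx].
HB.instance Definition _ := [Choice of SU2 by <:].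

Lemma su2_unitary (A : SU2) : su2mx A \is unitarymx.
Proof. by case/andP: (su2mxP A). Qed.

Lemma su2_det (A : SU2) : \det (su2mx A) = 1.
Proof. by case/andP: (su2mxP A) => _ /eqP. Qed.

Lemma su2_mul_subproof (A B : SU2) :
  (su2mx A *m su2mx B \is unitarymx) && (\det (su2mx A *m su2mx B) == 1).
Proof. by rewrite mul_unitarymx ?su2_unitary //= det_mulmx !su2_det mulr1. Qed.

Lemma su2_one_subproof :
  ((1%:M : 'M[R[i]]_2) \is unitarymx) && (\det (1%:M : 'M[R[i]]_2) == 1).
Proof.
rewrite det1 eqxx andbT; apply/unitarymxP.
by rewrite trmx1 map_mx1 mul1mx.
Qed.

Lemma su2_inv_subproof (A : SU2) :
  (invmx (su2mx A) \is unitarymx) && (\det (invmx (su2mx A)) == 1).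
Proof.
rewrite det_inv su2_det invr1 eqxx andbT.
by rewrite invmx_unitary ?su2_unitary // trmxC_unitary su2_unitary.
Qed.

Definition su2_mul (A B : SU2) := MkSU2 (su2_mul_subproof A B).
Definition su2_one := MkSU2 su2_one_subproof.
Definition su2_inv (A : SU2) := MkSU2 (su2_inv_subproof A).

Lemma su2_mulA : associative su2_mul.
Proof. by move=> A B C; apply: val_inj; apply: mulmxA. Qed.

Lemma su2_mul1 : left_id su2_one su2_mul.
Proof. by move=> A; apply: val_inj; apply: mul1mx. Qed.

Lemma su2_1mul : right_id su2_one su2_mul.
Proof. by move=> A; apply: val_inj; apply: mulmx1. Qed.

Lemma su2_mulV : left_inverse su2_one su2_inv su2_mul.
Proof.
move=> A; apply: val_inj; apply: mulVmx.
exact/unitarymx_unit/su2_unitary.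
Qed.

Lemma su2_Vmul : right_inverse su2_one su2_inv su2_mul.
Proof.
move=> A; apply: val_inj; apply: mulmxV.
exact/unitarymx_unit/su2_unitary.
Qed.

HB.instance Definition _ :=
  isGroup.Build SU2 su2_mulA su2_mul1 su2_1mul su2_mulV su2_Vmul.
HB.instance Definition _ := isPointed.Build SU2 su2_one.

(* The real vector space M_2(C), written M_2(R) + i M_2(R); this gives access
   to its real topology and to real derivatives. *)
Definition su2_coord (A : SU2) : 'M[R]_2 * 'M[R]_2 :=
  (map_mx (@complex.Re R) (su2mx A), map_mx (@complex.Im R) (su2mx A)).

HB.instance Definition _ := Topological.copy SU2 (initial_topology su2_coord).

HB.instance Definition _ :=
  Measurable.copy SU2 (g_sigma_algebraType (@open SU2)).

End SU2.

Section Measures.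
Context (R : realType).

(* A Borel probability on a compact metric group is Radon, so left invariance
   characterizes the normalized Haar measure. *)
Definition is_haar (m : probability (SU2 R) R) : Prop :=
  forall (a : SU2 R) (B : set (SU2 R)), measurable B ->
    m ((fun q : SU2 R => (a * q)%g) @^-1` B) = m B.

Definition measure_preserving d (T : measurableType d)
    (mu : set T -> \bar R) (f : T -> T) : Prop :=
  measurable_fun setT f /\
  forall B, measurable B -> pushforward mu f B = mu B.

End Measures.

(* Submanifolds are given together with an embedding in a normed space; tangent
   vectors are vectors of that ambient space. *)
Structure embedded (R : realType) := Embedded {
  points :> Type;
  ambient : normedModType R;
  embedding : points -> ambient }.
Arguments ambient {R} e.
Arguments embedding {R} e _.

Canonical SU2_embedded (R : realType) := Embedded (@su2_coord R).

Canonical prod_embedded (R : realType) (M N : embedded R) : embedded R :=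
  @Embedded R (M * N)%type (ambient M * ambient N)%type
    (fun p => (embedding M p.1, embedding N p.2)).

Section Forms.
Context (R : realType).
Implicit Types M N : embedded R.

(* c is a curve through p with velocity v at time 0 *)
Definition has_velocity M (c : R -> M) (p : M) (v : ambient M) : Prop :=
  c 0 = p /\ is_derive (0 : R^o) 1 (embedding M \o c) v.

Definition tangent M (p : M) (v : ambient M) : Prop :=
  exists c : R -> M, has_velocity c p v.

(* The differential of f at p maps the velocity of c to that of f \o c; the
   value is junk if v is not tangent at p or f is not differentiable there. *)
Definition differential M N (f : M -> N) (p : M) (v : ambient M) : ambient N :=
  get [set w | exists c : R -> M, has_velocity c p v /\
                                  has_velocity (f \o c) (f p) w].

(* Forms and metrics are only meaningful on tangent vectors. *)
Definition diff_form M (k : nat) := M -> ('I_k -> ambient M) -> R.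

Definition tangent_frame M k (p : M) (v : 'I_k -> ambient M) : Prop :=
  forall i, tangent p (v i).

Definition form_eq M k (a b : diff_form M k) : Prop :=
  forall (p : M) (v : 'I_k -> ambient M), tangent_frame p v -> a p v = b p v.

Definition is_form M k (a : diff_form M k) : Prop :=
  (forall (p : M) (v : 'I_k -> ambient M) (i : 'I_k) (c : R) (u w : ambient M),
     tangent_frame p v -> tangent p u -> tangent p w ->
     a p [eta v with i |-> c *: u + w] =
     c * a p [eta v with i |-> u] + a p [eta v with i |-> w]) /\
  (forall (p : M) (v : 'I_k -> ambient M) (i j : 'I_k),
     tangent_frame p v -> i != j -> v i = v j -> a p v = 0).

Definition pullback M N k (f : M -> N) (a : diff_form N k) : diff_form M k :=
  fun p v => a (f p) (fun i => differential f p (v i)).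

Definition scale_form M k (c : R) (a : diff_form M k) : diff_form M k :=
  fun p v => c * a p v.

Definition wedge_form M k l (a : diff_form M k) (b : diff_form M l) :
    diff_form M (k + l) :=
  fun p v => ((k`!)%:R * (l`!)%:R)^-1 *
    \sum_(s : 'S_(k + l)) (-1) ^+ s *
      a p (fun i => v (s (lshift l i))) * b p (fun j => v (s (rshift k j))).

Definition is_metric M (g : M -> ambient M -> ambient M -> R) : Prop :=
  [/\ forall (p : M) (c : R) (u v w : ambient M),
        tangent p u -> tangent p v -> tangent p w ->
        g p (c *: u + v) w = c * g p u w + g p v w,
      forall (p : M) (u v : ambient M),
        tangent p u -> tangent p v -> g p u v = g p v u
    & forall (p : M) (u : ambient M),
        tangent p u -> u != 0 -> 0 < g p u u].

Definition isometric M (g : M -> ambient M -> ambient M -> R) (f : M -> M) :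
    Prop :=
  forall (p : M) (u v : ambient M), tangent p u -> tangent p v ->
    g (f p) (differential f p u) (differential f p v) = g p u v.

Definition unit_on_orthonormal M k (g : M -> ambient M -> ambient M -> R)
    (a : diff_form M k) : Prop :=
  forall (p : M) (e : 'I_k -> ambient M), tangent_frame p e ->
    (forall i j, g p (e i) (e j) = (i == j)%:R) -> `|a p e| = 1.

Definition orientation_preserving M k (vol : diff_form M k)
    (f : M -> M) : Prop :=
  forall (p : M) (v : 'I_k -> ambient M), tangent_frame p v ->
    0 < vol p v -> 0 < pullback f vol p v.

Definition lmul (a q : SU2 R) : SU2 R := (a * q)%g.
Definition rmul (a q : SU2 R) : SU2 R := (q * a)%g.

(* nu is the volume form of some bi-invariant Riemannian metric g. Bi-invariance
   of nu makes the sign on orthonormal frames consistent, i.e. it comes from one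
   of the two orientations; left invariance also makes g and nu smooth, so that
   smoothness need not be required separately. *)
Definition biinvariant_volume_form (nu : diff_form (SU2_embedded R) 3) : Prop :=
  exists g : SU2_embedded R -> ambient (SU2_embedded R) ->
             ambient (SU2_embedded R) -> R,
    [/\ is_metric g,
        forall a : SU2 R, isometric g (lmul a) /\ isometric g (rmul a),
        is_form nu,
        unit_on_orthonormal g nu
      & forall a : SU2 R,
          form_eq (pullback (lmul a) nu) nu /\
          form_eq (pullback (rmul a) nu) nu].

Definition SU2_square : embedded R :=
  prod_embedded (SU2_embedded R) (SU2_embedded R).

Definition Omega (nu : diff_form (SU2_embedded R) 3) :
    diff_form SU2_square (3 + 3) :=
  wedge_form (pullback (M := SU2_square) (N := SU2_embedded R) fst nu)
        (pullback (M := SU2_square) (N := SU2_embedded R) snd nu).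

Definition quaternionic_nielsen (Phi : GroupAut F2) :
    SU2_square -> SU2_square :=
  @nielsen_map (SU2 R) Phi.

Definition quaternionic_lift (A : 'M[int]_2) (F : SU2_square -> SU2_square) :
    Prop :=
  exists Phi : GroupAut F2,
    row_exponent Phi = A /\ F = quaternionic_nielsen Phi.

End Forms.

Arguments quaternionic_nielsen : clear implicits.

(* Main.v *)
Require Import Defs.
From HB Require Import structures.
From mathcomp Require Import all_boot all_order all_fingroup all_algebra.
From mathcomp Require Import spectral sesquilinear complex.
From mathcomp Require Import all_classical all_reals all_analysis.
From mathcomp Require Import measurable_realfun.
From mathcomp Require Import zify ring lra.

Set Implicit Arguments.
Unset Strict Implicit.
Unset Printing Implicit Defensive.

Import Order.TTheory GRing.Theory Num.Theory.
Import numFieldNormedType.Exports.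

Local Open Scope classical_set_scope.
Local Open Scope ring_scope.

(* By Nielsen's theorem, Aut(F_2) is generated by x <-> y, x -> x^-1 and
   x -> y x, and F_(Phi N) = F_N o F_Phi; so it suffices to treat the maps
   (p, q) -> (q, p), (p^-1, q) and (q p, q). They preserve m x m by Fubini and
   the invariance of m under translations and inversion. In the left
   trivialization Omega is a multiple of the 6x6 determinant; the differential
   of (p, q) -> (q p, q) becomes a block unitriangular matrix, that of the swap
   a block swap of determinant (-1)^9, and inversion reverses the sign of nu
   because it acts on tangent vectors by v -> - p^-1 v p^-1 with nu
   bi-invariant. Each map thus multiplies Omega by the determinant of its row
   exponent matrix.

   Nielsen's theorem is proved by descent on the lengths of the images u, v of
   x, y and then on the codes of the initial halves of u, u^-1, v, v^-1. For a
   minimal pair no letter of a reduced word cancels completely when u, v are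
   substituted, so substitution does not decrease length; since x and y are
   words in u and v, these words are letters. *)

(** * Reduced words and common prefixes *)

Section LongestCommonPrefix.
Context (T : eqType).
Implicit Types s t u : seq T.
Local Open Scope nat_scope.

Fixpoint lcp s t : nat :=
  match s, t with
  | a :: s', b :: t' => if a == b then (lcp s' t').+1 else 0
  | _, _ => 0
  end.

Lemma lcpC s t : lcp s t = lcp t s.
Proof. by elim: s t => [|a s IH] [|b t] //=; rewrite eq_sym IH. Qed.

Lemma lcp_size s t : lcp s t <= size s.
Proof. by elim: s t => [|a s IH] [|b t] //=; case: ifP => // _; apply: IH. Qed.

Lemma lcp_sizer s t : lcp s t <= size t.
Proof. by rewrite lcpC lcp_size. Qed.

Lemma take_lcp n s t : n <= lcp s t -> take n s = take n t.
Proof.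
elim: n s t => [|n IH] [|a s] [|b t] //=.
by case: eqP => //= -> /IH->.
Qed.

Lemma leq_lcp n s t :
  n <= size s -> n <= size t -> take n s = take n t -> n <= lcp s t.
Proof.
elim: n s t => [//|n IH] [|a s] [|b t] //= ns nt [-> e].
by rewrite eqxx; apply: IH.
Qed.

(** Agreement on an initial segment is transitive, so [lcp] behaves as an ultrametric valuation. *)
Lemma lcp_ultra n s t u : n <= lcp s t -> n <= lcp t u -> n <= lcp s u.
Proof.
move=> nst ntu; apply: leq_lcp.
- exact: leq_trans nst (lcp_size _ _).
- exact: leq_trans ntu (lcp_sizer _ _).
- by rewrite (take_lcp nst) (take_lcp ntu).
Qed.

(** In an ultrametric, the two smallest of the three values agree. This lets cancellation against a
    long product be read off its first factor. *)
Lemma lcp_isosceles s t u : lcp s t < lcp t u -> lcp s u = lcp s t.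
Proof.
move=> lt; apply/eqP; rewrite eqn_leq; apply/andP; split; last first.
  by apply: (@lcp_ultra _ _ t) => //; apply: ltnW.
rewrite leqNgt; apply/negP => lt'.
have : (lcp s t).+1 <= lcp s t by apply: (@lcp_ultra _ _ u); rewrite ?(lcpC u).
by rewrite ltnn.
Qed.

End LongestCommonPrefix.

Section Words.
Local Open Scope nat_scope.
Implicit Types (a b : letter) (u v w : seq letter).

Lemma invw_cons a u : invw (a :: u) = rcons (invw u) (linv a).
Proof. by rewrite /invw /= rev_cons. Qed.

Lemma size_invw u : size (invw u) = size u.
Proof. by rewrite /invw size_rev size_map. Qed.

Lemma mulw_reduced u w : reduced (u ++ w) -> mulw u w = u ++ w.
Proof.
elim: u => //= a u IH rau; rewrite IH; last exact: reduced_tail rau.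
case: (u ++ w) rau => //= b v; rewrite /reduced /=.
by move=> /andP[/negPf-> _].
Qed.

(** Free cancellation between [invw u] and [w] removes exactly the common prefix of [u] and [w],
    once from each factor. *)
Lemma size_mulw_invw u w : reduced u -> reduced w ->
  size (mulw (invw u) w) + (lcp u w).*2 = size u + size w.
Proof.
elim: u w => [|a u IH] w ru rw /=; first by rewrite addn0.
rewrite invw_cons -cats1 mulw_cat /=.
have rau := ru; move/reduced_tail in ru.
(* Nothing cancels when the first letters differ; the default [linv a] of [head] puts the empty [w]
   into this case. *)
have mulE : head (linv a) w != a ->
    size (mulw (invw u) (linv a :: w)) = size (a :: u) + size w.
  move=> h; rewrite mulw_reduced ?size_cat ?size_invw /= ?addnS //.
  have := reduced_invw rau; rewrite invw_cons /reduced -cats1.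
  case: w rw h {IH} => [//|b w] /= rw h.
  by rewrite !sorted_cat_cons /= => /andP[-> _] /=; rewrite linvK h.
case: w rw mulE => [|b w] rw mulE.
  by rewrite mulE ?addn0 // eq_sym linv_neq.
rewrite /= linvK (eq_sym a); case: (eqVneq b a) => [_|nb].
  by have := IH w ru (reduced_tail rw); lia.
by rewrite mulE ?addn0.
Qed.

(** If a nonempty reduced word agreed with its inverse up to the middle, its middle letter would be
    its own inverse (odd length), or its two middle letters would cancel (even length). *)
Lemma lcp_invw_self u : reduced u -> u != [::] ->
  (lcp u (invw u)).*2 < size u.
Proof.
move=> ru u0; rewrite ltnNge; apply/negP => le.
have szu : 0 < size u by case: u u0 {ru le}.
pose c := (size u).-1./2.
have a0 : letter by case: u u0 {ru le szu c}.
have cl : c < lcp u (invw u) by rewrite /c; lia.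
have : nth a0 u c = nth a0 (invw u) c.
  by rewrite -(nth_take _ cl) (take_lcp (leqnn _)) nth_take.
have cu : c < size u by rewrite (leq_trans cl) ?lcp_size.
rewrite /invw nth_rev ?size_map // (nth_map a0); last by lia.
have [od|ev] := boolP (odd (size u)).
  have -> : size u - c.+1 = c by rewrite /c; lia.
  by move/eqP; apply/negP/linv_neq.
have -> : size u - c.+1 = c.+1 by rewrite /c; lia.
have c1 : c.+1 < size u by rewrite /c; lia.
move=> e; have : nth a0 u c.+1 != linv (nth a0 u c).
  by move/sortedP: ru => /(_ a0 c c1).
by rewrite e linvK eqxx.
Qed.

Definition code_letter a : nat := (val a.1).*2 + a.2.

(** Reading a word as a base 4 numeral turns the lexicographic order on words of equal length into
    an order of natural numbers, where descent is available. *)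
Definition word_code w : nat := foldl (fun n a => n * 4 + code_letter a) 0 w.

Lemma code_letter_lt a : code_letter a < 4.
Proof. by case: a => [[[|[|i]] Hi] []]. Qed.

Lemma code_letter_inj : injective code_letter.
Proof.
case=> [[i Hi] s] [[j Hj] t] /=; rewrite /code_letter /= => e.
have eij : i = j by move: Hi Hj; case: s e => e; case: t e => e; lia.
congr (_, _); first exact: val_inj.
by move: e; rewrite eij => /addnI; case: s; case: t.
Qed.

Lemma word_code_rcons w a : word_code (rcons w a) = word_code w * 4 + code_letter a.
Proof. by rewrite /word_code foldl_rcons. Qed.

Lemma word_code_inj u v : size u = size v -> word_code u = word_code v -> u = v.
Proof.
elim/last_ind: u v => [|u a IH] v; first by case: v.
case/lastP: v => [|v b]; first by rewrite size_rcons.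
rewrite !size_rcons !word_code_rcons => -[suv] e.
have := code_letter_lt a; have := code_letter_lt b => la lb.
have ec : word_code u = word_code v by lia.
have ea : code_letter a = code_letter b by lia.
by rewrite (IH v suv ec) (code_letter_inj ea).
Qed.

Lemma word_code_cat_lt u v s t : word_code u < word_code v -> size s = size t ->
  word_code (u ++ s) < word_code (v ++ t).
Proof.
move=> uv; elim/last_ind: s t => [|s a IH] t.
  by case: t => // _; rewrite !cats0.
case/lastP: t => [|t b]; first by rewrite size_rcons.
rewrite !size_rcons -!rcons_cat !word_code_rcons => -[st].
by have := IH _ st; have := code_letter_lt a; lia.
Qed.

Definition halfcode w : nat := word_code (take (uphalf (size w)) w).

End Words.

(** * Bases of the free group *)

Section Substitution.
Context (G : groupType).
Implicit Types (q : G) (a : letter) (u v w : F2).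
Local Open Scope group_scope.

(** Names the factor in the body of [subst], which is thus convertible to a product of [lett]
    terms. *)
Definition lett q1 q2 a : G :=
  let q := if a.1 == ord0 then q1 else q2 in if a.2 then q^-1 else q.

Lemma lett_linv q1 q2 a : lett q1 q2 (linv a) = (lett q1 q2 a)^-1.
Proof. by case: a => i []; rewrite /lett /linv //= invgK. Qed.

Lemma prod_mulw q1 q2 s t :
  \prod_(a <- mulw s t) lett q1 q2 a =
  \prod_(a <- s) lett q1 q2 a * \prod_(a <- t) lett q1 q2 a.
Proof.
elim: s => [|a s IH]; first by rewrite big_nil mul1g.
rewrite big_cons -mulgA -IH /=; case: (mulw s t) => [|b w] /=.
  by rewrite big_cons.
case: eqP => [->|_]; last by rewrite big_cons.
by rewrite big_cons lett_linv mulVKg.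
Qed.

Lemma substM q1 q2 : {morph subst q1 q2 : u v / u * v}.
Proof. by move=> u v; apply: prod_mulw. Qed.

Lemma subst1 q1 q2 : subst q1 q2 1 = 1.
Proof. exact: big_nil. Qed.

Lemma substV q1 q2 : {morph subst q1 q2 : u / u^-1}.
Proof.
move=> u; apply: (mulgI (subst q1 q2 u)).
by rewrite -substM !mulgV subst1.
Qed.

Lemma subst_gen0 q1 q2 : subst q1 q2 (gen ord0) = q1.
Proof. exact: big_seq1. Qed.

Lemma subst_gen1 q1 q2 : subst q1 q2 (gen ord_max) = q2.
Proof. exact: big_seq1. Qed.

End Substitution.

Section FreeGroup.
Local Open Scope group_scope.
Implicit Types (a b c : letter) (u v w : F2).

Lemma subst_lett (G : groupType) (q1 q2 : G) u v a :
  subst q1 q2 (lett u v a) = lett (subst q1 q2 u) (subst q1 q2 v) a.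
Proof. by rewrite /lett; case: a.2; case: ifP => _ //; rewrite substV. Qed.

Lemma subst_subst (G : groupType) (q1 q2 : G) u v w :
  subst q1 q2 (subst u v w) = subst (subst q1 q2 u) (subst q1 q2 v) w.
Proof.
have -> : subst u v w = \prod_(a <- word w) lett u v a by [].
rewrite (big_morph _ (substM q1 q2) (subst1 q1 q2)).
by apply: eq_bigr => a _; rewrite subst_lett.
Qed.

Lemma lett_gen a : word (lett (gen ord0) (gen ord_max) a) = [:: a].
Proof.
case: a => [[[|[|i]] Hi] []] //=; rewrite /lett /=;
  by congr [:: (_, _)]; apply: val_inj.
Qed.

Lemma subst_id w : subst (gen ord0) (gen ord_max) w = w.
Proof.
apply: val_inj => /=; rewrite -[RHS]mulw_nil ?word_reduced //.
rewrite /subst /mulw; elim: (word w) => [|a s IH]; first by rewrite big_nil.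
rewrite big_cons /= -IH.
by have /= := lett_gen a; rewrite /lett => ->.
Qed.

Lemma aut_subst (Phi : GroupAut F2) w :
  Phi w = subst (Phi (gen ord0)) (Phi (gen ord_max)) w.
Proof.
have Phi1 : Phi 1 = 1.
  by apply: (mulgI (Phi 1)); rewrite -gmulfM !mulg1.
have PhiV u : Phi u^-1 = (Phi u)^-1.
  by apply: (mulgI (Phi u)); rewrite -gmulfM !mulgV.
rewrite -{1}[w]subst_id.
have -> : subst (gen ord0) (gen ord_max) w =
  \prod_(a <- word w) lett (gen ord0) (gen ord_max) a by [].
rewrite (big_morph Phi (gmulfM (s := aut_fun Phi)) Phi1); apply: eq_bigr => a _.
by rewrite /lett; case: a.2; case: ifP => _ //; rewrite PhiV.
Qed.

(** The inverse and right-handed versions of these elementary moves are combinations of the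
    three. *)
Definition nielsen_closed (P : F2 -> F2 -> Prop) : Prop :=
  [/\ forall u v, P u v -> P v u,
      forall u v, P u v -> P u^-1 v
    & forall u v, P u v -> P (v * u) v].

(** The elementary move that multiplies the image of the letter [c] on the left by that of [b]. If
    [c] is an inverse letter the product is inverted before it is stored, since the pair holds
    images of generators. *)
Definition nielsen_step u v b c : F2 * F2 :=
  let w := lett u v b * lett u v c in
  let w' := if c.2 then w^-1 else w in
  if c.1 == ord0 then (w', v) else (u, w').

Lemma ord2_neq0 (i : 'I_2) : (i == ord0) = false -> i = ord_max.
Proof. by case: i => [[|[|i]] Hi] // _; apply: val_inj. Qed.

Lemma nielsen_step_closed P u v b c : nielsen_closed P -> b.1 != c.1 ->
  P u v -> P (nielsen_step u v b c).1 (nielsen_step u v b c).2.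
Proof.
case=> sw iv ml.
(* Left multiplication by [v'^-1] is left multiplication conjugated by inversion of the second word;
   the right multiplications follow by inverting the first word. *)
have mVl u' v' : P u' v' -> P (v'^-1 * u') v'.
  by move=> /sw/iv/sw/ml/sw/iv/sw; rewrite invgK.
have mr u' v' : P u' v' -> P (u' * v') v'.
  by move=> /iv/mVl/iv; rewrite invgM !invgK.
have mVr u' v' : P u' v' -> P (u' * v'^-1) v'.
  by move=> /iv/ml/iv; rewrite invgM invgK.
case: b c => [i s] [j t] /= ij.
have [ei|ei] := eqVneq i ord0; have [ej|ej] := eqVneq j ord0.
- by rewrite ei ej eqxx in ij.
- move: ej => /negPf ej Puv; rewrite /nielsen_step /lett /= ei ej eqxx /=.
  case: s; case: t; rewrite ?invgM ?invgK; apply: (sw); move/sw: Puv;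
    by [apply: mr | apply: mVl | apply: mVr | apply: ml].
- move: ei => /negPf ei Puv; rewrite /nielsen_step /lett /= ei ej eqxx /=.
  case: s; case: t; rewrite ?invgM ?invgK; move: Puv;
    by [apply: mr | apply: mVl | apply: mVr | apply: ml].
- move: ei ej ij => /negPf/ord2_neq0 -> /negPf/ord2_neq0 ->.
  by rewrite eqxx.
Qed.

Lemma lett_step_neq u v b c d : c.1 != d.1 ->
  lett (nielsen_step u v b c).1 (nielsen_step u v b c).2 d = lett u v d.
Proof.
rewrite /nielsen_step /lett; have [ec|ec] := eqVneq c.1 ord0 => cd /=.
  by move: cd; rewrite ec eq_sym => /negPf->.
move: cd; rewrite (ord2_neq0 (negPf ec)).
have [-> //|/negPf/ord2_neq0 -> //] := eqVneq d.1 ord0.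
Qed.

Lemma lett_step_eq u v b c :
  lett (nielsen_step u v b c).1 (nielsen_step u v b c).2 c =
  lett u v b * lett u v c.
Proof.
rewrite /nielsen_step {1}/lett; have [ec|/negPf ec] := eqVneq c.1 ord0.
  by case: c.2 => //=; rewrite invgK.
by case: c.2 => //=; rewrite invgK.
Qed.

Lemma nielsen_stepK u v b c : b.1 != c.1 ->
  let s := nielsen_step u v b c in nielsen_step s.1 s.2 (linv b) c = (u, v).
Proof.
move=> bc /=; rewrite {1}/nielsen_step lett_linv lett_step_neq; last first.
  by rewrite eq_sym.
rewrite lett_step_eq mulKg /nielsen_step /lett.
by case: (c.1 == ord0); case: c.2; rewrite /= ?invgK.
Qed.

(** The endomorphisms given by [(u, v)] and by [(s, t)] are mutually inverse, so the pair is the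
    image of the standard basis under an automorphism. *)
Definition F2_basis u v : Prop := exists s t,
  [/\ subst s t u = gen ord0, subst s t v = gen ord_max,
      subst u v s = gen ord0 & subst u v t = gen ord_max].

Lemma F2_basis_subst u v n1 n2 : F2_basis u v -> F2_basis n1 n2 ->
  F2_basis (subst u v n1) (subst u v n2).
Proof.
move=> [s [t [su tv us vt]]] [m1 [m2 [m1E m2E n1E n2E]]].
have Kl w : subst (subst m1 m2 s) (subst m1 m2 t) (subst u v w) = subst m1 m2 w.
  by rewrite -subst_subst (subst_subst s) su tv subst_id.
have Kr w : subst (subst u v n1) (subst u v n2) (subst m1 m2 w) = subst u v w.
  by rewrite -subst_subst (subst_subst n1) n1E n2E subst_id.
by exists (subst m1 m2 s), (subst m1 m2 t); rewrite !Kl !Kr m1E m2E us vt.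
Qed.

(** Each move is a substitution of [u], [v] into an elementary basis whose inverse is written down
    explicitly. *)
Lemma F2_basis_closed : nielsen_closed F2_basis.
Proof.
split=> u v buv.
- have : F2_basis (gen ord_max) (gen ord0).
    exists (gen ord_max), (gen ord0).
    by rewrite !subst_gen0 !subst_gen1.
  by move=> /(F2_basis_subst buv); rewrite subst_gen0 subst_gen1.
- have : F2_basis (gen ord0)^-1 (gen ord_max).
    exists (gen ord0)^-1, (gen ord_max).
    by rewrite !substV !subst_gen0 !subst_gen1 invgK.
  by move=> /(F2_basis_subst buv); rewrite substV subst_gen0 subst_gen1.
- have : F2_basis (gen ord_max * gen ord0) (gen ord_max).
    exists ((gen ord_max)^-1 * gen ord0), (gen ord_max).
    by rewrite !substM !substV !subst_gen0 !subst_gen1 mulVKg mulKg.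
  by move=> /(F2_basis_subst buv); rewrite substM subst_gen0 subst_gen1.
Qed.

Lemma F2_basis_aut (Phi : GroupAut F2) : F2_basis (Phi (gen ord0)) (Phi (gen ord_max)).
Proof.
have [Psi PhiK PsiK] := aut_bij Phi.
(* The inverse function is again an automorphism, so it too acts by substitution, and its values at
   the generators are the witnesses. *)
have PsiM : {morph Psi : u v / u * v}.
  by move=> u v; apply: (can_inj PhiK); rewrite gmulfM !PsiK.
pose PsiMul := isMultiplicative.Build F2 F2 Psi PsiM.
pose PsiF : {multiplicative F2 -> F2} := HB.pack Psi PsiMul.
have PsiE w := @aut_subst (@MkGroupAut F2 PsiF (Bijective PsiK PhiK)) w.
exists (Psi (gen ord0)), (Psi (gen ord_max)).
by rewrite -!PsiE -!aut_subst /= !PhiK !PsiK.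
Qed.

End FreeGroup.

(** * Nielsen reduction *)

Section NielsenReduction.
Local Open Scope group_scope.
Local Open Scope nat_scope.
Implicit Types (a b c : letter) (u v w : F2).

Lemma size_invg u : size (u^-1)%g = size u.
Proof. exact: size_invw. Qed.

(* invgM itself leaves the product in a form that lia does not recognize. *)
Lemma invF2M u w : ((u * w)^-1 = w^-1 * u^-1)%g.
Proof. exact: invgM. Qed.

Lemma size_invgM u w : size (u^-1 * w)%g + (lcp u w).*2 = size u + size w.
Proof. exact: size_mulw_invw (word_reduced u) (word_reduced w). Qed.

Lemma size_mulg u w : size (u * w)%g + (lcp (u^-1)%g w).*2 = size u + size w.
Proof. by rewrite -(size_invg u) -size_invgM invgK. Qed.

(** The part of [u] surviving in [u * w] is its common prefix with [u * w]. The equation comes from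
    comparing the lengths of [u * w] and of [(u * w)^-1 * u = w^-1]. *)
Lemma lcp_mulg u w : lcp (u * w)%g u + lcp (u^-1)%g w = size u.
Proof.
have := size_invgM (u * w)%g u; have := size_mulg u w.
rewrite invF2M mulgVK size_invg; lia.
Qed.

Lemma lcp_invg_self u : u != 1%g -> (lcp u (u^-1)%g).*2 < size u.
Proof. by move=> u1; apply: lcp_invw_self (word_reduced u) _. Qed.

(** Adding the code of the inverse makes the measure invariant under inversion, as the length is. *)
Definition inv_halfcode u := halfcode u + halfcode (u^-1)%g.

Lemma inv_halfcodeV u : inv_halfcode (u^-1)%g = inv_halfcode u.
Proof. by rewrite /inv_halfcode invgK addnC. Qed.

(* u = p q^-1 with p, q of equal length, and w = q w', hence u w = p w'. *)
Lemma inv_halfcode_mulg u w : let h := lcp (u^-1)%g w in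
  h.*2 = size u -> h.*2 <= size w ->
  word_code (take h u) < word_code (take h (u^-1)%g) ->
  inv_halfcode (u * w)%g < inv_halfcode w.
Proof.
move=> h hu hw lt_code.
have sz : size (u * w)%g = size w by have := size_mulg u w; rewrite -/h; lia.
have hl : lcp (u * w)%g u = h by have := lcp_mulg u w; rewrite -/h; lia.
have take_split (t : F2) : size t = size w -> take (uphalf (size t)) t =
    take h t ++ drop h (take (uphalf (size t)) t).
  move=> st; rewrite -[LHS](cat_take_drop h); congr (_ ++ _).
  by rewrite take_takel //; lia.
(* The first summand drops: [u * w] begins with the first [h] letters of [u], where [w] begins with
   those of [u^-1], and the leading letters decide the comparison. *)
rewrite /inv_halfcode -addSn leq_add //.
  rewrite /halfcode take_split // [X in _ < word_code X]take_split // word_code_cat_lt //.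
    rewrite (take_lcp (_ : h <= lcp (u * w)%g u)) ?hl //.
    by rewrite -(take_lcp (leqnn (lcp (u^-1)%g w))).
  by rewrite !size_drop !size_take_min sz.
rewrite /halfcode !size_invg sz.
(* The second summand is unchanged: the inverses of [u * w] and [w] share [size w - h] letters,
   which is at least half. *)
suff -> : take (uphalf (size w)) (u * w)^-1%g = take (uphalf (size w)) w^-1%g.
  by [].
apply: take_lcp; rewrite invF2M.
have := lcp_mulg (w^-1)%g (u^-1)%g; rewrite invgK lcpC [X in _ + X]lcpC.
by rewrite -/h size_invg [lcp (w^-1)%g _]lcpC; lia.
Qed.

Section Reduced.
(** [A] stands for the images of the four letters under a minimal pair: by the last two hypotheses
    no move shortens an image, or lowers its code at equal length. *)
Variable A : letter -> F2.
Hypothesis A_linv : forall a, A (linv a) = (A a)^-1%g.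
Hypothesis A_neq1 : forall a, A a != 1%g.
Hypothesis step_size : forall b c, b.1 != c.1 ->
  size (A c) <= size (A b * A c)%g.
Hypothesis step_code : forall b c, b.1 != c.1 ->
  size (A b * A c)%g = size (A c) ->
  inv_halfcode (A c) <= inv_halfcode (A b * A c)%g.

(** Cancelling more than half of either factor would make [A b * A c] shorter than the other one;
    the bound for [A b] uses the inverse product. *)
Lemma lcp_half b c : b.1 != c.1 ->
  (lcp (A b)^-1%g (A c)).*2 <= size (A b) /\
  (lcp (A b)^-1%g (A c)).*2 <= size (A c).
Proof.
move=> bc; have s1 := step_size bc.
have : size (A (linv b)) <= size (A (linv c) * A (linv b))%g.
  by apply: step_size; rewrite eq_sym.
rewrite !A_linv -invF2M !size_invg.
by have := size_mulg (A b) (A c); lia.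
Qed.

(** The core of the reduction: in a reduced word the neighbours of [b] never cancel [A b]
    completely. A neighbour equal to [b] takes less than half of it, any other at most half. *)
Lemma lcp_triple a b c : b != linv a -> c != linv b ->
  lcp (A a)^-1%g (A b) + lcp (A b)^-1%g (A c) < size (A b).
Proof.
have same_letter x y : y != linv x -> x.1 = y.1 -> y = x.
  case: x y => [i s] [j t]; rewrite /linv /= => + ij; rewrite -ij.
  by rewrite xpair_eqE eqxx /=; case: s; case: t.
have selfb : (lcp (A b)^-1%g (A b)).*2 < size (A b).
  by rewrite lcpC lcp_invg_self ?A_neq1.
move=> ba cb.
have [ab|ab] := eqVneq a.1 b.1.
  rewrite -(same_letter a b) //.
  have [bc|bc] := eqVneq b.1 c.1; first by rewrite (same_letter b c) //; lia.
  by have [] := lcp_half bc; lia.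
have [bc|bc] := eqVneq b.1 c.1.
  by rewrite (same_letter b c) //; have [] := lcp_half ab; lia.
(* Complete cancellation now forces both neighbours to take exactly half of [A b]. *)
rewrite ltnNge; apply/negP => le.
have [l1 l2] := lcp_half ab; have [l3 l4] := lcp_half bc.
set L := lcp (A a)^-1%g (A b) in le l1 l2.
have eL : lcp (A b)^-1%g (A c) = L by lia.
have Lb : L.*2 = size (A b) by lia.
have Ls : L <= size (A b) by lia.
(* The halves differ, as [A b] and its inverse share less than half their length. Whichever has the
   smaller code yields a length-preserving move that lowers the code, on [A c] or on
   [A (linv a)]. *)
have : word_code (take L (A b)) != word_code (take L (A b)^-1%g).
  apply/eqP => /word_code_inj; rewrite !size_takel ?size_invg // => /(_ erefl) e.
  have : L <= lcp (A b) (A b)^-1%g by apply: leq_lcp; rewrite ?size_invg.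
  by rewrite lcpC; lia.
rewrite neq_ltn => /orP[lt|lt].
  have : inv_halfcode (A b * A c)%g < inv_halfcode (A c).
    by apply: inv_halfcode_mulg; rewrite eL // -eL.
  rewrite ltnNge step_code //.
  by have := size_mulg (A b) (A c); lia.
have : inv_halfcode (A (linv b) * A (linv a))%g < inv_halfcode (A (linv a)).
  by apply: inv_halfcode_mulg; rewrite !A_linv invgK lcpC ?size_invg.
have ba1 : (linv b).1 != (linv a).1 by rewrite eq_sym.
rewrite ltnNge step_code //.
have := size_mulg (A (linv b)) (A (linv a)).
by rewrite !A_linv invgK (lcpC (A b)) -/L !size_invg; lia.
Qed.

(** The second conclusion strengthens the induction: the product keeps more of [A b] than any
    admissible preceding letter can cancel. *)
Lemma size_prod_cons b (s : seq letter) h : reduced (b :: s) ->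
  h = (\prod_(a <- b :: s) A a)%g ->
  lcp h (A b) + size s <= size h /\
  forall a, b != linv a -> lcp (A a)^-1%g (A b) < lcp h (A b).
Proof.
have lcp_refl (t : F2) : lcp t t = size t.
  by apply/eqP; rewrite eqn_leq lcp_size leq_lcp.
elim: s b h => [|c s IH] b h rbs.
  rewrite big_seq1 => ->; rewrite lcp_refl addn0; split=> // a ba.
  by have := @lcp_triple a b b ba (linv_neq b); lia.
have cb : c != linv b by move: rbs; rewrite /reduced /= => /andP[].
rewrite big_cons => ->; set h' := (\prod_(a <- _) _)%g.
have [sz gt] : _ /\ _ := IH c h' (reduced_tail rbs) erefl.
(* Since [h'] agrees with [A c] further than [(A b)^-1] does, [A b] cancels against [h'] exactly as
   against [A c]. *)
have Lbc : lcp (A b)^-1%g h' = lcp (A b)^-1%g (A c).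
  by apply: lcp_isosceles; rewrite (lcpC (A c)); apply: gt.
have := lcp_mulg (A b) h'; have := size_mulg (A b) h'; rewrite Lbc => e1 e2.
split=> [|a ba]; last by have := lcp_triple ba cb; lia.
by have := gt b cb; rewrite [size (c :: s)]/=; lia.
Qed.

Lemma size_prod_reduced (w : F2) : size w <= size (\prod_(a <- word w) A a)%g.
Proof.
case: w => [[//|b s] rw]; have [le gt] := size_prod_cons rw erefl.
apply: leq_trans le; rewrite [size _]/= -add1n leq_add2r.
exact: leq_ltn_trans (leq0n _) (gt b (linv_neq b)).
Qed.

End Reduced.

(** A move changes the total of [f] by exactly the change at the letter [c]; the additive form
    avoids truncated subtraction. *)
Lemma nielsen_step_sum (f : F2 -> nat) u v b c :
    (forall w, f (w^-1)%g = f w) ->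
  f (nielsen_step u v b c).1 + f (nielsen_step u v b c).2 + f (lett u v c) =
  f (lett u v b * lett u v c)%g + (f u + f v).
Proof.
move=> fV; rewrite /nielsen_step; move: (lett u v b * _)%g => w.
rewrite /lett; case: (c.1 == ord0); case: c.2; rewrite /= ?fV; lia.
Qed.

Lemma nielsen_closed_F2_basis (P : F2 -> F2 -> Prop) : nielsen_closed P ->
  P (gen ord0) (gen ord_max) -> forall u v, F2_basis u v -> P u v.
Proof.
move=> clP Pxy.
suff: forall n k u v, size u + size v = n ->
    inv_halfcode u + inv_halfcode v = k -> F2_basis u v -> P u v.
  by move=> H u v; apply: H.
(* Lexicographic descent: total length first, then total code at fixed length. *)
elim/ltn_ind => n IHn; elim/ltn_ind => k IHk u v un uk buv.
have [[b [c [bc dec]]]|nodec] := pselect (exists b c, b.1 != c.1 /\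
    let s := nielsen_step u v b c in
    size s.1 + size s.2 < n \/ (size s.1 + size s.2 = n /\
      inv_halfcode s.1 + inv_halfcode s.2 < k)).
  have bs := nielsen_step_closed F2_basis_closed bc buv.
  (* The induction hypothesis gives [P] at the smaller pair, and the inverse move carries it back to
     [(u, v)]. *)
  suff Ps : P (nielsen_step u v b c).1 (nielsen_step u v b c).2.
    have bc' : (linv b).1 != c.1 by [].
    by have := nielsen_step_closed clP bc' Ps; rewrite nielsen_stepK.
  case: dec => [lt|[e lt]]; first by apply: (IHn _ lt).
  by apply: (IHk _ lt).
have [s [t [su tv us vt]]] := buv.
have u1 : u != 1%g by apply/eqP => u1; move: su; rewrite u1 subst1.
have v1 : v != 1%g by apply/eqP => v1; move: tv; rewrite v1 subst1.
have step_size b c : b.1 != c.1 ->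
    size (lett u v c) <= size (lett u v b * lett u v c)%g.
  move=> bc; rewrite leqNgt; apply/negP => lt; apply: nodec; exists b, c.
  by have := nielsen_step_sum u v b c size_invg; split=> //; left; lia.
have step_code b c : b.1 != c.1 ->
    size (lett u v b * lett u v c)%g = size (lett u v c) ->
    inv_halfcode (lett u v c) <= inv_halfcode (lett u v b * lett u v c)%g.
  move=> bc e; rewrite leqNgt; apply/negP => lt; apply: nodec; exists b, c.
  have := nielsen_step_sum u v b c size_invg.
  by have := nielsen_step_sum u v b c inv_halfcodeV; split=> //; right; lia.
have lett_neq1 a : lett u v a != 1%g.
  by rewrite /lett; case: a.2; case: ifP => _; rewrite ?invg_eq1.
(* The image of [w] is a single letter and substitution does not shorten reduced words, so [w] is a
   single letter too. *)
have len w a : subst u v w = lett (gen ord0) (gen ord_max) a ->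
    exists b, word w = [:: b] /\
      lett u v b = lett (gen ord0) (gen ord_max) a.
  move=> e; have := size_prod_reduced (lett_linv u v) lett_neq1 step_size step_code w.
  rewrite -[(\prod_(a <- _) _)%g]/(subst u v w).
  rewrite e lett_gen; case: w e => [[|b [|b' s']] rw] //= e _.
    by move: (lett_gen a); rewrite -e /subst big_nil.
  by exists b; split=> //; rewrite -e /subst /= big_seq1.
have [sw iv _] := clP.
have [a [_ ua]] := len s (ord0, false) us.
have [b [_ vb]] := len t (ord_max, false) vt.
rewrite {}/len in ua vb.
(* The letters mapping to the two generators belong to different generators, since otherwise their
   images would be equal or inverse. Hence [(u, v)] is the standard basis up to order and
   inversion. *)
have ab : a.1 != b.1.
  apply/eqP => ab; have : word (lett u v a) = word (lett u v b) \/
      word (lett u v a) = word (lett u v (linv b)).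
    case: a b ab {ua vb} => [i p] [j q] /= ->.
    by case: p; case: q; [left|right|right|left].
  by rewrite lett_linv ua vb; case.
have iv2 u' v' : P u' v' -> P u' v'^-1%g by move=> /sw/iv/sw.
have : P (lett u v a) (lett u v b) by rewrite ua vb.
case: a b ab {ua vb} => [i p] [j q] /= ij; rewrite /lett /=.
have [ei|/negPf ei] := eqVneq i ord0; have [ej|/negPf ej] := eqVneq j ord0.
- by rewrite ei ej eqxx in ij.
- by case: p; case: q => //; [move/iv/iv2|move/iv|move/iv2]; rewrite !invgK.
- by case: p; case: q; [move/iv/iv2|move/iv|move/iv2|]; rewrite ?invgK => /sw.
- by rewrite (ord2_neq0 ei) (ord2_neq0 ej) eqxx in ij.
Qed.
End NielsenReduction.

(** * Real coordinates on SU(2) *)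

Section Coordinates.
Context (R : realType).
Implicit Types (A B : SU2 R) (X Y : 'M[R]_2 * 'M[R]_2).

Lemma ord2P (i : 'I_2) : i = ord0 \/ i = ord_max.
Proof. by case: i => [[|[|i]] Hi] //; [left|right]; apply: val_inj. Qed.

Lemma sum_ord2 (V : nmodType) (F : 'I_2 -> V) :
  \sum_i F i = F ord0 + F ord_max.
Proof.
by rewrite big_ord_recr big_ord1 /=; congr (F _ + _); apply: val_inj.
Qed.

Lemma ReD (x y : R[i]) : complex.Re (x + y) = complex.Re x + complex.Re y.
Proof. by case: x; case: y. Qed.

Lemma ImD (x y : R[i]) : complex.Im (x + y) = complex.Im x + complex.Im y.
Proof. by case: x; case: y. Qed.

Lemma ReM (x y : R[i]) : complex.Re (x * y) =
  complex.Re x * complex.Re y - complex.Im x * complex.Im y.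
Proof. by case: x; case: y. Qed.

Lemma ImM (x y : R[i]) : complex.Im (x * y) =
  complex.Re x * complex.Im y + complex.Im x * complex.Re y.
Proof. by case: x; case: y. Qed.

(* Multiplication and conjugate transpose of M_2(C) = M_2(R) + i M_2(R). *)
Definition mxc_mul X Y : 'M[R]_2 * 'M[R]_2 :=
  (X.1 *m Y.1 - X.2 *m Y.2, X.1 *m Y.2 + X.2 *m Y.1).
Definition mxc_adj X : 'M[R]_2 * 'M[R]_2 := (X.1^T, - X.2^T).

Lemma su2_coordM A B :
  su2_coord (A * B)%g = mxc_mul (su2_coord A) (su2_coord B).
Proof.
congr (_, _); apply/matrixP => i j; rewrite !mxE !sum_ord2 !mxE.
  by rewrite ReD !ReM; ring.
by rewrite ImD !ImM; ring.
Qed.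

Lemma su2_coord1 : su2_coord (1%g : SU2 R) = (1%:M, 0).
Proof.
by congr (_, _); apply/matrixP => i j; rewrite !mxE; case: (i == j).
Qed.

Lemma su2_mxV A : su2mx (A^-1)%g = map_mx Num.conj (su2mx A)^T.
Proof. exact/invmx_unitary/su2_unitary. Qed.

Lemma su2_coordV A : su2_coord (A^-1)%g = mxc_adj (su2_coord A).
Proof.
rewrite /su2_coord su2_mxV.
by congr (_, _); apply/matrixP => i j; rewrite !mxE; case: (su2mx A j i).
Qed.

Lemma mxc_mulA : associative mxc_mul.
Proof.
move=> X Y Z; rewrite /mxc_mul /= !mulmxBl !mulmxBr !mulmxDl !mulmxDr !mulmxA.
by congr (_, _); rewrite ?opprB ?opprD; apply/matrixP => i j;
  rewrite !mxE; ring.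
Qed.

Lemma mxc_mul1 X : mxc_mul (1%:M, 0) X = X.
Proof. by case: X => a b; rewrite /mxc_mul /= !mul1mx !mul0mx subr0 addr0. Qed.

Lemma mxc_1mul X : mxc_mul X (1%:M, 0) = X.
Proof.
by case: X => a b; rewrite /mxc_mul /= !mulmx1 !mulmx0 subr0 add0r.
Qed.

Lemma mxc_mulDl X Y Z : mxc_mul (X + Y) Z = mxc_mul X Z + mxc_mul Y Z.
Proof.
congr (_, _); rewrite /= !mulmxDl; apply/matrixP => i j; rewrite !mxE; ring.
Qed.

Lemma mxc_mulDr X Y Z : mxc_mul Z (X + Y) = mxc_mul Z X + mxc_mul Z Y.
Proof.
congr (_, _); rewrite /= !mulmxDr; apply/matrixP => i j; rewrite !mxE; ring.
Qed.

Lemma mxc_mulZl (c : R) X Y : mxc_mul (c *: X) Y = c *: mxc_mul X Y.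
Proof. by congr (_, _); rewrite /= -!scalemxAl ?scalerBr ?scalerDr. Qed.

Lemma mxc_mulZr (c : R) X Y : mxc_mul X (c *: Y) = c *: mxc_mul X Y.
Proof. by congr (_, _); rewrite /= -!scalemxAr ?scalerBr ?scalerDr. Qed.

Lemma mxc_mulN X Y : mxc_mul (- X) Y = - mxc_mul X Y.
Proof. by rewrite -scaleN1r mxc_mulZl scaleN1r. Qed.

Lemma su2_coord_inj : injective (@su2_coord R).
Proof.
move=> A B [/matrixP eR /matrixP eI]; apply/val_inj/matrixP => i j.
have := eR i j; have := eI i j; rewrite !mxE /=.
by case: (su2mx A i j) => a b; case: (su2mx B i j) => c d /= -> ->.
Qed.

(* The real span of SU(2) in M_2(C): the quaternions. *)
Definition is_quat X : Prop :=
  [/\ X.1 ord_max ord_max = X.1 ord0 ord0,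
      X.2 ord_max ord_max = - X.2 ord0 ord0,
      X.1 ord_max ord0 = - X.1 ord0 ord_max
    & X.2 ord_max ord0 = X.2 ord0 ord_max].

(** The inverse of a matrix in SU(2) is both its conjugate transpose and its adjugate; comparing
    entries gives the relations. *)
Lemma su2_quat A : is_quat (su2_coord A).
Proof.
have adjE : su2mx (A^-1)%g = adjugate (su2mx A).
  transitivity (invmx (su2mx A)) => //.
  by rewrite /invmx unitarymx_unit ?su2_unitary // su2_det invr1 scale1r.
rewrite su2_mxV in adjE.
have e00 := congr1 (fun M : 'M[R[i]]_2 => M ord0 ord0) adjE.
have e01 := congr1 (fun M : 'M[R[i]]_2 => M ord0 ord_max) adjE.
rewrite !mxE /cofactor det_mx11 !mxE /= expr0 mul1r in e00.
rewrite !mxE /cofactor det_mx11 !mxE /= expr1 mulN1r in e01.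
have l0 : lift ord0 (0 : 'I_1) = ord_max :> 'I_2 by apply: val_inj.
have l1 : lift ord_max (0 : 'I_1) = ord0 :> 'I_2 by apply: val_inj.
rewrite ?l0 ?l1 in e00 e01.
rewrite /is_quat /= !mxE -e00 -[su2mx A ord0 ord_max]opprK -e01.
by case: (su2mx A ord0 ord0) => a b; case: (su2mx A ord_max ord0) => c d /=;
  rewrite ?opprK.
Qed.

(** This is the top left entry of [A * A^-1 = 1], the inverse being the conjugate transpose. *)
Lemma su2_quat_norm A : let X := su2_coord A in
  X.1 ord0 ord0 ^+ 2 + X.2 ord0 ord0 ^+ 2 +
  (X.1 ord0 ord_max ^+ 2 + X.2 ord0 ord_max ^+ 2) = 1.
Proof.
move=> X; have := congr1 (fun M : 'M[R]_2 * 'M[R]_2 => M.1 ord0 ord0) (su2_coordM A (A^-1)%g).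
rewrite mulgV su2_coord1 su2_coordV /= !mxE !sum_ord2 !mxE eqxx => e.
rewrite [RHS](_ : 1 = true%:R) // e /X /= ?mxE; ring.
Qed.

End Coordinates.

(** * Haar measure *)

Section Measurability.
Context (R : realType).
Local Notation M2C := ('M[R]_2 * 'M[R]_2)%type.

Lemma measurable_su2_coord i j :
  measurable_fun setT (fun A : SU2 R => (su2_coord A).1 i j) /\
  measurable_fun setT (fun A : SU2 R => (su2_coord A).2 i j).
Proof.
have cc : continuous (@su2_coord R : SU2 R -> M2C) by apply: initial_continuous.
have meas (f : SU2 R -> R) : continuous f -> measurable_fun setT f.
  move=> /continuousP cf; apply: (measurability _ (RGenOInfty.measurableE R)).
  move=> _ [_ [x ->] <-]; rewrite setTI; apply: sub_sigma_algebra.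
  by apply: cf; apply: interval_open.
split; apply: meas => A.
  apply: (continuous_comp (cc A) (g := fun X : M2C => X.1 i j)).
  apply: (continuous_comp (g := fun X : 'M[R]_2 => X i j)).
    exact: cvg_fst.
  exact: coord_continuous.
apply: (continuous_comp (cc A) (g := fun X : M2C => X.2 i j)).
apply: (continuous_comp (g := fun X : 'M[R]_2 => X i j)).
  exact: cvg_snd.
exact: coord_continuous.
Qed.

(** Boxes with rational centre and radius form a countable base of the topology, through which
    coordinatewise measurability reaches all open sets. *)
Definition ratbox (c : 'M[rat]_2 * 'M[rat]_2 * rat) : set M2C :=
  [set X : M2C | forall i j, `|ratr (c.1.1 i j) - X.1 i j| < ratr c.2 /\
                       `|ratr (c.1.2 i j) - X.2 i j| < ratr c.2].

Lemma open_ratbox (V : set M2C) : open V ->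
  V = \bigcup_(c in [set c | ratbox c `<=` V]) ratbox c.
Proof.
move=> oV; rewrite eqEsubset; split=> [X VX|X [c cV] /cV //].
have /nbhs_ballP[/= e e0 eV] : nbhs X V by rewrite openE in oV; apply: oV.
(* The centre is only within [r] of [X], so points of the box are within [2 * r] of [X]; hence the
   radius below [e / 2]. *)
have /rat_in_itvoo[r] : 0 < e / 2 by rewrite divr_gt0.
rewrite in_itv /= => /andP[r0 re].
have approx (x : R) : exists q : rat, `|ratr q - x| < ratr r.
  have /rat_in_itvoo[q] : x - ratr r < x + ratr r by lra.
  rewrite in_itv /= => /andP[q1 q2]; exists q.
  by rewrite ltr_norml; apply/andP; split; lra.
pose c : 'M[rat]_2 * 'M[rat]_2 * rat :=
  (\matrix_(i, j) sval (cid (approx (X.1 i j))),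
   \matrix_(i, j) sval (cid (approx (X.2 i j))), r).
have tri (a x y : R) : `|a - x| < ratr r -> `|a - y| < ratr r -> `|x - y| < e.
  rewrite !ltr_norml => /andP[? ?] /andP[? ?]; apply/andP; split; lra.
exists c => [Y cY|i j] /=; last first.
  rewrite /c /= !mxE; split; [exact: (svalP (cid (approx (X.1 i j))))|].
  exact: (svalP (cid (approx (X.2 i j)))).
apply: eV; split; split=> // i j; have [] := cY i j; rewrite /c /= !mxE => h1 h2.
  exact: tri (svalP (cid (approx (X.1 i j)))) h1.
exact: tri (svalP (cid (approx (X.2 i j)))) h2.
Qed.

Lemma measurable_fun_su2 d (T : measurableType d) (f : T -> SU2 R) :
  (forall i j, measurable_fun setT (fun t => (su2_coord (f t)).1 i j)) ->
  (forall i j, measurable_fun setT (fun t => (su2_coord (f t)).2 i j)) ->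
  measurable_fun setT f.
Proof.
move=> mf1 mf2; apply: (measurability (@open (SU2 R))) => //.
(* An open set of SU(2) comes from an open [V], a countable union of rational boxes, and each box is
   a finite intersection of coordinate conditions. *)
move=> _ [_ [V oV <-] <-]; rewrite setTI (open_ratbox oV) !preimage_bigcup.
rewrite bigcup_mkcond; apply: countable_bigcupT_measurable; first exact: countableP.
move=> c; case: ifP => // _.
rewrite [X in measurable X](_ : _ = \bigcap_(ij : 'I_2 * 'I_2)
  ((fun t => (su2_coord (f t)).1 ij.1 ij.2) @^-1`
      [set x | `|ratr (c.1.1 ij.1 ij.2) - x| < ratr c.2] `&`
   (fun t => (su2_coord (f t)).2 ij.1 ij.2) @^-1`
      [set x | `|ratr (c.1.2 ij.1 ij.2) - x| < ratr c.2])); last first.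
  rewrite eqEsubset; split=> t /= ht; first by move=> [i j] _; apply: ht.
  by move=> i j; apply: (ht (i, j)).
have mb (a b : R) : measurable [set x | `|a - x| < b].
  rewrite (_ : mkset _ = `]a - b, a + b[%classic) //.
  by apply/seteqP; split=> x /=; rewrite in_itv /= ltr_distlC; move=> /andP[? ?];
    apply/andP; split; lra.
apply: fin_bigcap_measurable => // -[i j] _.
by apply: measurableI; rewrite -[X in measurable X]setTI; [apply: mf1|apply: mf2].
Qed.

Lemma measurable_su2_mul d (T : measurableType d) (f g : T -> SU2 R) :
  measurable_fun setT f -> measurable_fun setT g ->
  measurable_fun setT (fun t => (f t * g t)%g).
Proof.
move=> mf mg.
have f1 i j := measurableT_comp (measurable_su2_coord i j).1 mf.
have f2 i j := measurableT_comp (measurable_su2_coord i j).2 mf.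
have g1 i j := measurableT_comp (measurable_su2_coord i j).1 mg.
have g2 i j := measurableT_comp (measurable_su2_coord i j).2 mg.
apply: measurable_fun_su2 => i j; under eq_fun do
  rewrite su2_coordM /= !mxE !sum_ord2; 
  [apply: measurable_funB|apply: measurable_funD]; apply: measurable_funD;
  apply: measurable_funM; by [apply: f1|apply: f2|apply: g1|apply: g2].
Qed.

Lemma measurable_su2_inv d (T : measurableType d) (f : T -> SU2 R) :
  measurable_fun setT f -> measurable_fun setT (fun t => (f t)^-1%g).
Proof.
move=> mf.
have f1 i j := measurableT_comp (measurable_su2_coord i j).1 mf.
have f2 i j := measurableT_comp (measurable_su2_coord i j).2 mf.
apply: measurable_fun_su2 => i j.
  by under eq_fun do rewrite su2_coordV /= mxE; apply: (f1 j i).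
under eq_fun do rewrite su2_coordV /= mxE mxE.
by apply: measurable_funN; apply: (f2 j i).
Qed.

End Measurability.

Section HaarMeasure.
Context (R : realType) (m : probability (SU2 R) R).
Local Open Scope ereal_scope.
Local Notation G := (SU2 R).

(** Tonelli for indicators: integrating sections in either order gives the same measure, by
    uniqueness of the product measure. *)
Lemma product_measure21 (A : set (G * G)) : measurable A ->
  (m \x m) A = (m \x^ m) A.
Proof.
move=> mA; apply: product_measure_unique => // B C mB mC.
by rewrite /= product_measure2E.
Qed.

Hypothesis hm : is_haar m.

Lemma integral_prob_cst (c : \bar R) : \int[m]_(x in setT) c = c.
Proof. by rewrite integral_cst //= [X in _ * X](probability_setT m) mule1. Qed.

(* Integrate the indicator of x^-1 y in B in both orders. *)
Lemma haar_inv (B : set G) : measurable B ->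
  m ((fun q : G => q^-1%g) @^-1` B) = m B.
Proof.
move=> mB; pose A : set (G * G) := (fun q => (q.1^-1 * q.2)%g) @^-1` B.
have mA : measurable A.
  have mf : measurable_fun setT (fun q : G * G => (q.1^-1 * q.2)%g).
    apply: measurable_su2_mul; last exact: measurable_snd.
    exact: (measurable_su2_inv (@measurable_fst _ _ G G)).
  by rewrite -[A]setTI; apply: mf.
have mV : measurable ((fun q : G => q^-1%g) @^-1` B).
  have mf := measurable_su2_inv (@measurable_id _ G setT).
  by rewrite -[X in measurable X]setTI; apply: mf.
have := product_measure21 mA; rewrite /product_measure1 /product_measure2 /=.
under eq_integral => x _.
  rewrite (_ : xsection A x = (fun q => (x^-1 * q)%g) @^-1` B); last first.
    by rewrite xsectionE.
  rewrite hm //; over.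
(* For fixed [y], the element [x^-1 * y] is the inverse of [y^-1 * x], so this section is a left
   translate of the inverse of [B]. *)
under [RHS]eq_integral => y _.
  rewrite (_ : ysection A y =
      (fun q => (y^-1 * q)%g) @^-1` ((fun q : G => q^-1%g) @^-1` B)); last first.
    rewrite ysectionE; apply/funext => x.
    by rewrite /A /preimage /= invgM invgK.
  rewrite hm //; over.
by rewrite !integral_prob_cst.
Qed.

Lemma measure_preserving_comp (f g : G * G -> G * G) :
  measure_preserving (m \x m) f -> measure_preserving (m \x m) g ->
  measure_preserving (m \x m) (f \o g).
Proof.
move=> [mf pf] [mg pg]; split; first exact: measurableT_comp.
move=> B mB; rewrite -(pf B mB); apply: pg.
by rewrite -[X in measurable X]setTI; apply: mf.
Qed.

Lemma measure_preserving_swap :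
  measure_preserving (m \x m) (fun q : G * G => (q.2, q.1)).
Proof.
have msw : measurable_fun [set: G * G] (fun q : G * G => (q.2, q.1)).
  by apply: measurable_fun_pair.
by split=> // B mB; rewrite [RHS]product_measure21.
Qed.

(** For fixed second coordinate the map acts on the section by [h y], which preserves [m];
    integrating over [y] concludes. *)
Lemma measure_preserving_fst (h : G -> G -> G) :
  measurable_fun setT (fun q : G * G => h q.2 q.1) ->
  (forall y (B : set G), measurable B -> m (h y @^-1` B) = m B) ->
  measure_preserving (m \x m) (fun q : G * G => (h q.2 q.1, q.2)).
Proof.
move=> mh ph.
have mh2 : measurable_fun setT (fun q : G * G => (h q.2 q.1, q.2)).
  by apply: measurable_fun_pair.
split=> // B mB; rewrite /pushforward !product_measure21 //; last first.
  by rewrite -[X in measurable X]setTI; apply: mh2.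
apply: eq_integral => y _ /=; rewrite -(ph y (ysection B y)); last exact: measurable_ysection.
by rewrite !ysectionE.
Qed.

Lemma measure_preserving_inv :
  measure_preserving (m \x m) (fun q : G * G => (q.1^-1%g, q.2)).
Proof.
apply: (measure_preserving_fst (h := fun _ x => x^-1%g)).
  exact: (measurable_su2_inv (@measurable_fst _ _ G G)).
by move=> _ B mB; apply: haar_inv.
Qed.

Lemma measure_preserving_mul :
  measure_preserving (m \x m) (fun q : G * G => ((q.2 * q.1)%g, q.2)).
Proof.
apply: (measure_preserving_fst (h := fun y x => (y * x)%g)).
  by apply: measurable_su2_mul.
by move=> y B mB; apply: hm.
Qed.

End HaarMeasure.

(** * Velocities and differentials *)

Section Derivatives.
Context (R : realType).
Local Notation M2C := ('M[R]_2 * 'M[R]_2)%type.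

Lemma is_derive_cvg (V W : normedModType R) (f : V -> W) (a v : V) (l : W) :
  is_derive a v f l <->
  (fun h : R => h^-1 *: ((f \o shift a) (h *: v) - f a)) @ 0^' --> l.
Proof.
split=> [[df <-] //|fl]; apply: DeriveDef; first by apply/cvg_ex; exists l.
exact/cvg_lim.
Qed.

Lemma is_derive_unique (V W : normedModType R) (f : V -> W) (a v : V) (l k : W) :
  is_derive a v f l -> is_derive a v f k -> l = k.
Proof. by move=> [_ <-] [_ <-]. Qed.

Lemma is_derive_pair (V W1 W2 : normedModType R) (f : V -> W1) (g : V -> W2)
    (a v : V) (l : W1 * W2) :
  is_derive a v (fun t => (f t, g t)) l <->
  is_derive a v f l.1 /\ is_derive a v g l.2.
Proof.
rewrite !is_derive_cvg; case: l => l1 l2; split=> [fg|[fl gl]] /=.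
  split.
    have c1 : (@fst W1 W2) @ nbhs (l1, l2) --> l1 by exact: cvg_fst.
    exact: (cvg_comp _ _ fg c1).
  have c2 : (@snd W1 W2) @ nbhs (l1, l2) --> l2 by exact: cvg_snd.
  exact: (cvg_comp _ _ fg c2).
exact: (cvg_pair fl gl).
Qed.

Lemma is_derive_mx (V : normedModType R) m n (f : V -> 'M[R]_(m, n)) (a v : V)
    (l : 'M[R]_(m, n)) :
  is_derive a v f l <-> forall i j, is_derive a v (fun t => f t i j) (l i j).
Proof.
split=> [[df <-] i j|fl].
  apply: DeriveDef; last by rewrite derive_mx // mxE.
  by move: i j; apply/derivable_mxP.
have df : derivable f a v by apply/derivable_mxP => i j; case: (fl i j).
apply: DeriveDef => //; apply/matrixP => i j; rewrite derive_mx // mxE.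
by case: (fl i j).
Qed.

Lemma is_derive_M2C (f : R^o -> M2C) (a v : R^o) (l : M2C) :
  is_derive a v f l <->
  (forall i j, is_derive a v (fun t => (f t).1 i j : R^o) (l.1 i j)) /\
  (forall i j, is_derive a v (fun t => (f t).2 i j : R^o) (l.2 i j)).
Proof.
rewrite (_ : f = fun t => ((f t).1, (f t).2)); last first.
  by apply/funext => t; case: (f t).
by rewrite is_derive_pair !is_derive_mx.
Qed.

Lemma is_derive_mxc_mul (a : R^o) (f g : R^o -> M2C) (l k : M2C) :
  is_derive a 1 f l -> is_derive a 1 g k ->
  is_derive a 1 (fun t => mxc_mul (f t) (g t)) (mxc_mul l (g a) + mxc_mul (f a) k).
Proof.
move=> /is_derive_M2C[f1 f2] /is_derive_M2C[g1 g2].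
apply/is_derive_M2C; split=> i j /=; under eq_fun do rewrite !mxE !sum_ord2;
  rewrite !mxE !sum_ord2.
  by apply: is_derive_eq; rewrite /GRing.scale /=; ring.
by apply: is_derive_eq; rewrite /GRing.scale /=; ring.
Qed.

Lemma is_derive_mxc_adj (a : R^o) (f : R^o -> M2C) (l : M2C) :
  is_derive a 1 f l -> is_derive a 1 (fun t => mxc_adj (f t)) (mxc_adj l).
Proof.
move=> /is_derive_M2C[f1 f2]; apply/is_derive_M2C; split=> i j /=.
  by rewrite mxE; under eq_fun do rewrite mxE; apply: f1.
rewrite !mxE; under eq_fun do rewrite !mxE.
by apply: is_deriveN; apply: f2.
Qed.

Lemma is_derive_rescale (f : R^o -> M2C) (k : R) (l : M2C) :
  is_derive (0 : R^o) 1 f l -> is_derive (0 : R^o) 1 (fun t => f (k * t)) (k *: l).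
Proof.
move=> /is_derive_M2C[f1 f2].
have dk : is_derive (0 : R^o) 1 (fun t : R^o => k * t : R^o) k.
  by apply: is_derive_eq; rewrite /GRing.scale /=; ring.
apply/is_derive_M2C; split=> i j; rewrite mxE mulrC.
  apply: (@is_derive1_comp _ (fun t => (f t).1 i j) (fun t => k * t)) dk.
  by rewrite mulr0; apply: f1.
apply: (@is_derive1_comp _ (fun t => (f t).2 i j) (fun t => k * t)) dk.
by rewrite mulr0; apply: f2.
Qed.

End Derivatives.

Section SmoothMaps.
Context (R : realType).

(* D is the differential of f at p, as seen along curves. *)
Definition curve_diff (M N : embedded R) (f : M -> N) (p : M)
    (D : ambient M -> ambient N) : Prop :=
  forall (c : R -> M) v, has_velocity c p v -> has_velocity (f \o c) (f p) (D v).

(** The set from which [get] chooses is a singleton: the velocity of the image curve depends on the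
    curve only through [v]. *)
Lemma differentialE (M N : embedded R) (f : M -> N) p D v :
  curve_diff f p D -> tangent p v -> differential f p v = D v.
Proof.
move=> fD [c cv]; apply: get_unique; first by exists c; split=> //; apply: fD.
by move=> w [d [/fD[_ d1] [_ d2]]]; apply: is_derive_unique d2 d1.
Qed.

Lemma curve_diff_tangent (M N : embedded R) (f : M -> N) p D v :
  curve_diff f p D -> tangent p v -> tangent (f p) (D v).
Proof. by move=> fD [c cv]; exists (f \o c); apply: fD. Qed.

Lemma curve_diff_comp (M N P : embedded R) (f : M -> N) (g : N -> P) p D D' :
  curve_diff f p D -> curve_diff g (f p) D' -> curve_diff (g \o f) p (D' \o D).
Proof. by move=> fD gD c v /fD/gD. Qed.

Definition curve_differentiable (M N : embedded R) (f : M -> N) : Prop :=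
  forall p, exists D, curve_diff f p D.

Lemma tangent_differential (M N : embedded R) (f : M -> N) p v :
  curve_differentiable f -> tangent p v -> tangent (f p) (differential f p v).
Proof.
move=> sf tv; have [D fD] := sf p.
by rewrite (differentialE fD tv); apply: curve_diff_tangent tv.
Qed.

Lemma curve_differentiable_comp (M N P : embedded R) (f : M -> N) (g : N -> P) :
  curve_differentiable f -> curve_differentiable g -> curve_differentiable (g \o f).
Proof.
move=> sf sg p; have [D fD] := sf p; have [D' gD] := sg (f p).
by exists (D' \o D); apply: curve_diff_comp.
Qed.

Lemma pullback_comp (M N P : embedded R) (f : M -> N) (g : N -> P) k
    (a : diff_form P k) : curve_differentiable f -> curve_differentiable g ->
  form_eq (pullback (g \o f) a) (pullback f (pullback g a)).
Proof.
move=> sf sg p v tv; have [D fD] := sf p; have [D' gD] := sg (f p).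
congr (a _ _); apply/funext => i.
rewrite (differentialE (curve_diff_comp fD gD) (tv i)).
rewrite (differentialE fD (tv i)) (differentialE gD) //.
exact: curve_diff_tangent (tv i).
Qed.

Lemma pullback_form_eq (M N : embedded R) (f : M -> N) k (a b : diff_form N k) :
  curve_differentiable f -> form_eq a b -> form_eq (pullback f a) (pullback f b).
Proof. by move=> sf ab p v tv; apply: ab => i; apply: tangent_differential. Qed.

End SmoothMaps.

Section VelocitySU2.
Context (R : realType).
Local Notation M2C := ('M[R]_2 * 'M[R]_2)%type.
Local Notation G := (SU2_embedded R).
Local Notation GG := (SU2_square R).
Implicit Types (p q a : SU2 R) (u v w : M2C).

Lemma velocity_cst (p : G) : has_velocity (fun=> p) p (0 : ambient G).
Proof. by split=> //; apply: is_derive_cst. Qed.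

Lemma velocity_mul (c d : R -> G) (p q : G) (v w : ambient G) :
  has_velocity c p v -> has_velocity d q w ->
  has_velocity (fun t => (c t * d t)%g : G) ((p * q)%g : G)
    (mxc_mul v (su2_coord q) + mxc_mul (su2_coord p) w : ambient G).
Proof.
move=> [cp cv] [dq dw]; split; first by rewrite cp dq.
have -> : embedding G \o (fun t => (c t * d t)%g : G) =
    fun t => mxc_mul (su2_coord (c t)) (su2_coord (d t)).
  by apply/funext => t; apply: su2_coordM.
by rewrite -cp -dq; apply: is_derive_mxc_mul.
Qed.

Lemma velocity_inv (c : R -> G) (p : G) (v : ambient G) :
  has_velocity c p v ->
  has_velocity (fun t => (c t)^-1%g : G) (p^-1%g : G) (mxc_adj v : ambient G).
Proof.
move=> [cp cv]; split; first by rewrite cp.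
have -> : embedding G \o (fun t => (c t)^-1%g : G) =
    fun t => mxc_adj (su2_coord (c t)).
  by apply/funext => t; apply: su2_coordV.
exact: is_derive_mxc_adj.
Qed.

Lemma velocity_rescale (c : R -> G) (p : G) (v : ambient G) (k : R) :
  has_velocity c p v -> has_velocity (fun t => c (k * t)) p (k *: v).
Proof.
move=> [cp cv]; split; first by rewrite mulr0.
exact: (is_derive_rescale k cv).
Qed.

Lemma velocity_pair (c : R -> GG) (p : GG) (v : ambient GG) :
  has_velocity c p v <->
  has_velocity (fun t => (c t).1 : G) (p.1 : G) (v.1 : ambient G) /\
  has_velocity (fun t => (c t).2 : G) (p.2 : G) (v.2 : ambient G).
Proof.
rewrite /has_velocity.
have -> : embedding GG \o c =
  fun t => (embedding G (c t).1, embedding G (c t).2) by [].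
rewrite is_derive_pair; split=> [[-> []] //|[[c1 d1] [c2 d2]]].
by split=> //; case: (c 0) p c1 c2 => x y [x' y'] /= -> ->.
Qed.

Lemma velocity_fst (c : R -> GG) (p : GG) (v : ambient GG) : has_velocity c p v ->
  has_velocity (fun t => (c t).1 : G) (p.1 : G) (v.1 : ambient G).
Proof. by move=> /velocity_pair[]. Qed.

Lemma velocity_snd (c : R -> GG) (p : GG) (v : ambient GG) : has_velocity c p v ->
  has_velocity (fun t => (c t).2 : G) (p.2 : G) (v.2 : ambient G).
Proof. by move=> /velocity_pair[]. Qed.

Lemma mxc_mul0 u : mxc_mul u 0 = 0.
Proof. by rewrite -[X in mxc_mul _ X](scale0r (0 : M2C)) mxc_mulZr scale0r. Qed.

Lemma mxc_0mul u : mxc_mul 0 u = 0.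
Proof. by rewrite -[X in mxc_mul X _](scale0r (0 : M2C)) mxc_mulZl scale0r. Qed.

Lemma su2_coordVl p : mxc_mul (su2_coord p^-1%g) (su2_coord p) = (1%:M, 0).
Proof. by rewrite -su2_coordM mulVg su2_coord1. Qed.

Lemma su2_coordVr p : mxc_mul (su2_coord p) (su2_coord p^-1%g) = (1%:M, 0).
Proof. by rewrite -su2_coordM mulgV su2_coord1. Qed.

Lemma curve_diff_lmul a (p : G) :
  curve_diff (lmul a : G -> G) p (mxc_mul (su2_coord a)).
Proof.
move=> c v cv; have := velocity_mul (velocity_cst a) cv.
by rewrite mxc_0mul add0r.
Qed.

Lemma curve_diff_rmul a (p : G) :
  curve_diff (rmul a : G -> G) p 
    (fun v : M2C => mxc_mul v (su2_coord a)).
Proof.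
move=> c v cv; have := velocity_mul cv (velocity_cst a).
by rewrite mxc_mul0 addr0.
Qed.

Lemma curve_diff_fst (p : GG) : curve_diff (fst : GG -> G) p fst.
Proof. by move=> c v /velocity_fst. Qed.

Lemma curve_diff_snd (p : GG) : curve_diff (snd : GG -> G) p snd.
Proof. by move=> c v /velocity_snd. Qed.

Definition swap_map (q : GG) : GG := (q.2, q.1).
Definition inv_map (q : GG) : GG := (q.1^-1%g, q.2).
Definition mul_map (q : GG) : GG := ((q.2 * q.1)%g, q.2).

Lemma curve_diff_swap (p : GG) : curve_diff swap_map p
  (fun v : ambient GG => (v.2, v.1) : ambient GG).
Proof. by move=> c v /velocity_pair[v1 v2]; apply/velocity_pair. Qed.

Lemma curve_diff_inv (p : GG) : curve_diff inv_map p
  (fun v : ambient GG => (mxc_adj v.1, v.2) : ambient GG).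
Proof.
move=> c v /velocity_pair[v1 v2]; apply/velocity_pair; split=> //=.
exact: velocity_inv.
Qed.

Lemma curve_diff_mul (p : GG) : curve_diff mul_map p
  (fun v : ambient GG => (mxc_mul v.2 (su2_coord p.1) +
                          mxc_mul (su2_coord p.2) v.1, v.2) : ambient GG).
Proof.
move=> c v /velocity_pair[v1 v2]; apply/velocity_pair; split=> //=.
exact: (velocity_mul v2 v1).
Qed.

Lemma tangent0 (p : G) : tangent p (0 : ambient G).
Proof. by exists (fun=> p); apply: velocity_cst. Qed.

(** The group structure adds velocities: [c t * p^-1 * d t] passes through [p] with velocity
    [u + v]. *)
Lemma tangentD (p : G) (u v : ambient G) :
  tangent p u -> tangent p v -> tangent p (u + v).
Proof.
move=> [c cu] [d dv]; exists (fun t => c t * (p^-1 * d t))%g.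
have := velocity_mul cu (velocity_mul (velocity_cst (p^-1)%g) dv).
rewrite mxc_0mul add0r mxc_mulA su2_coordVr mxc_mul1.
by rewrite su2_coordM su2_coordVl mxc_1mul mulVg mulg1.
Qed.

Lemma tangentZ (p : G) (k : R) (u : ambient G) : tangent p u -> tangent p (k *: u).
Proof. by move=> [c cu]; exists (fun t => c (k * t)); apply: velocity_rescale. Qed.

(** Differentiating [c t * (c t)^-1 = 1] gives the derivative of inversion as [- p^-1 v p^-1]. *)
Lemma mxc_adj_tangent (p : G) (v : ambient G) : tangent p v ->
  mxc_adj v = mxc_mul (- mxc_mul (su2_coord p^-1%g) v) (su2_coord p^-1%g).
Proof.
move=> [c cv]; have [_] := velocity_mul cv (velocity_inv cv).
have -> : embedding G \o (fun t => (c t * (c t)^-1)%g : G) = cst (1%:M, 0).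
  by apply/funext => t; rewrite /= mulgV su2_coord1.
move=> /is_derive_unique/(_ (is_derive_cst _ _ _)) /eqP.
rewrite addr_eq0 => /eqP e; rewrite mxc_mulN -mxc_mulA e.
by rewrite -[X in mxc_mul _ X]scaleN1r mxc_mulZr mxc_mulA su2_coordVl mxc_mul1
  scaleN1r opprK.
Qed.

End VelocitySU2.

Section TangentSpace.
Context (R : realType).
Local Notation M2C := ('M[R]_2 * 'M[R]_2)%type.
Local Notation G := (SU2_embedded R).
Implicit Types (p : SU2 R) (X v : M2C).

(** The quaternion a + bi + cj + dk as the complex matrix with rows (a + bi, c + di) and (- c + di,
    a - bi). *)
Definition quat (a b c d : R) : M2C :=
  (\matrix_(i, j) if i == ord0 then if j == ord0 then a else c
                  else if j == ord0 then - c else a,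
   \matrix_(i, j) if i == ord0 then if j == ord0 then b else d
                  else if j == ord0 then d else - b).

Lemma is_quatE X : is_quat X ->
  X = quat (X.1 ord0 ord0) (X.2 ord0 ord0) (X.1 ord0 ord_max) (X.2 ord0 ord_max).
Proof.
case: X => X Y [/= e1 e2 e3 e4]; congr (_, _); apply/matrixP => i j; rewrite mxE;
  by case: (ord2P i) => ->; case: (ord2P j) => ->.
Qed.

Lemma quatD a b c d a' b' c' d' :
  quat a b c d + quat a' b' c' d' = quat (a + a') (b + b') (c + c') (d + d').
Proof.
congr (_, _); apply/matrixP => i j; rewrite !mxE;
  by case: (i == ord0); case: (j == ord0); rewrite ?opprD.
Qed.

Lemma quatZ k a b c d : k *: quat a b c d = quat (k * a) (k * b) (k * c) (k * d).
Proof.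
congr (_, _); apply/matrixP => i j; rewrite !mxE;
  by case: (i == ord0); case: (j == ord0); rewrite ?mulrN.
Qed.

Lemma su2_of_quat a b c d : a ^+ 2 + b ^+ 2 + (c ^+ 2 + d ^+ 2) = 1 ->
  exists A : SU2 R, su2_coord A = quat a b c d.
Proof.
move=> n1; pose M : 'M[R[i]]_2 :=
  \matrix_(i, j) Complex ((quat a b c d).1 i j) ((quat a b c d).2 i j).
have uM : M \is unitarymx.
  apply/unitarymxP/matrixP => i j; rewrite !mxE sum_ord2 !mxE.
  case: (ord2P i) => ->; case: (ord2P j) => -> /=;
    apply/eqP; rewrite eq_complex /=; apply/andP; split; apply/eqP;
    rewrite ?mxE /=; move: n1; rewrite ?expr2 => n1; first [lra|ring].
have dM : \det M = 1.
  rewrite (expand_det_row _ ord0) sum_ord2 /cofactor !det_mx11 !mxE /=.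
  apply/eqP; rewrite eq_complex /=; apply/andP; split; apply/eqP;
    rewrite ?mxE /=; move: n1; rewrite ?expr2 => n1; first [lra|ring].
have PM : (M \is unitarymx) && (\det M == 1) by rewrite uM dM eqxx.
exists (MkSU2 PM); congr (_, _); apply/matrixP => i j; rewrite !mxE /= ?mxE;
  by case: (i == ord0); case: (j == ord0).
Qed.

(** The curve is cos t + sin t (bi + cj + dk), with the stated velocity at time 0. *)
Lemma tangent1_unit b c d : b ^+ 2 + c ^+ 2 + d ^+ 2 = 1 ->
  tangent (1%g : G) (quat 0 b c d : ambient G).
Proof.
move=> n1.
have cs (t : R) : exists A : SU2 R,
    su2_coord A = quat (cos t) (sin t * b) (sin t * c) (sin t * d).
  apply: su2_of_quat; rewrite -[RHS](cos2Dsin2 t) -[sin t ^+ 2]mulr1 -n1; ring.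
exists (fun t => sval (cid (cs t)) : G); split.
  apply: su2_coord_inj; rewrite (svalP (cid (cs 0))) su2_coord1 cos0 sin0 !mul0r.
  congr (_, _); apply/matrixP => i j; rewrite !mxE;
    by case: (ord2P i) => ->; case: (ord2P j) => ->; rewrite /= ?oppr0.
have -> : embedding G \o (fun t => sval (cid (cs t)) : G) =
    fun t => quat (cos t) (sin t * b) (sin t * c) (sin t * d).
  by apply/funext => t /=; rewrite (svalP (cid (cs t))).
have dc : is_derive (0 : R^o) 1 (cos : R^o -> R^o) 0.
  by apply: is_derive_eq; rewrite sin0 oppr0.
have ds x : is_derive (0 : R^o) 1 (fun t : R^o => sin t * x : R^o) x.
  by apply: is_derive_eq; rewrite /GRing.scale /= cos0; ring.
apply/is_derive_M2C; split=> i j; under eq_fun do rewrite mxE; rewrite mxE;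
  case: (i == ord0); case: (j == ord0); by [apply: dc|apply: ds|apply: is_deriveN; apply: ds].
Qed.

Lemma tangent1P (v : ambient G) : tangent (1%g : G) v <->
  exists x y z, v = quat 0 x y z.
Proof.
split=> [[c [c0 /is_derive_M2C[c1 c2]]]|[x [y [z ->]]]]; last first.
  have -> : quat 0 x y z = x *: quat 0 1 0 0 + y *: quat 0 0 1 0 + z *: quat 0 0 0 1.
    by rewrite !quatZ !quatD !mulr0 !mulr1 !addr0 !add0r.
  by apply: tangentD; [apply: tangentD|]; apply: tangentZ; apply: tangent1_unit; ring.
have eq_derive (f g : R^o -> R^o) (l k : R^o) : is_derive (0 : R^o) 1 f l ->
    is_derive (0 : R^o) 1 g k -> f = g -> l = k.
  by move=> fl gk fg; move: fl; rewrite fg => /is_derive_unique; apply.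
have qc t := su2_quat (c t).
(* The linear relations defining the quaternions pass from the curve to its derivative. *)
have qv : is_quat v.
  split.
  - by apply: eq_derive (c1 _ _) (c1 _ _) _; apply/funext => t; case: (qc t).
  - apply: eq_derive (c2 _ _) (is_deriveN (c2 _ _)) _; apply/funext => t.
    by case: (qc t).
  - apply: eq_derive (c1 _ _) (is_deriveN (c1 _ _)) _; apply/funext => t.
    by case: (qc t).
  - by apply: eq_derive (c2 _ _) (c2 _ _) _; apply/funext => t; case: (qc t).
exists (v.2 ord0 ord0), (v.1 ord0 ord_max), (v.2 ord0 ord_max).
rewrite [LHS](is_quatE qv); congr quat.
have c0E : su2_coord (c 0) = (1%:M, 0) by rewrite c0 su2_coord1.
have sq (f : R^o -> R^o) l : is_derive (0 : R^o) 1 f l ->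
    is_derive (0 : R^o) 1 (fun t => f t ^+ 2 : R^o) (2 * f 0 * l).
  move=> fl; apply: is_derive_eq (is_deriveX 2 fl) _.
  by rewrite /GRing.scale /= expr1.
(* Differentiating the unit norm equation at the identity kills the real part of [v]. *)
have dn := is_deriveD (is_deriveD (sq _ _ (c1 ord0 ord0)) (sq _ _ (c2 ord0 ord0)))
  (is_deriveD (sq _ _ (c1 ord0 ord_max)) (sq _ _ (c2 ord0 ord_max))).
have : 2 * (su2_coord (c 0)).1 ord0 ord0 * v.1 ord0 ord0 +
    2 * (su2_coord (c 0)).2 ord0 ord0 * v.2 ord0 ord0 +
    (2 * (su2_coord (c 0)).1 ord0 ord_max * v.1 ord0 ord_max +
     2 * (su2_coord (c 0)).2 ord0 ord_max * v.2 ord0 ord_max) = 0.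
  apply: (eq_derive _ _ _ _ dn (is_derive_cst (1 : R^o) _ _)).
  by apply/funext => t; apply: su2_quat_norm.
rewrite c0E /= !mxE /=.
lra.
Qed.

End TangentSpace.

(** * Volume forms *)

Section Determinants.

Definition det3 (R : comNzRingType) (x : 'I_3 -> 'I_3 -> R) : R :=
  let o1 : 'I_3 := Ordinal (isT : (1 < 3)%N) in
  x ord0 ord0 * (x o1 o1 * x ord_max ord_max - x o1 ord_max * x ord_max o1) -
  x ord0 o1 * (x o1 ord0 * x ord_max ord_max - x o1 ord_max * x ord_max ord0) +
  x ord0 ord_max * (x o1 ord0 * x ord_max o1 - x o1 o1 * x ord_max ord0).

Lemma det_mx33 (R : comNzRingType) (A : 'M[R]_3) : \det A = det3 A.
Proof.
rewrite (expand_det_row _ ord0) !big_ord_recl big_ord0 /cofactor.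
rewrite !(expand_det_row _ ord0) !big_ord_recl !big_ord0 /cofactor.
rewrite !(expand_det_row _ ord0) !big_ord_recl !big_ord0 /cofactor !det_mx00.
pose a k l := A (inord k) (inord l).
have AE i j : A i j = a i j by rewrite /a !inord_val.
rewrite !mxE /det3 !AE /= /bump /= !addn0 !add0n !addn1; ring.
Qed.

(* Summing over rho first leaves, for each block preserving rho, the Leibniz
   formula for the matrix with columns permuted by rho. *)
Lemma sum_perm_det_blocks (R : comNzRingType) m n : exists c : R,
  forall N : 'M[R]_(m + n),
  \sum_(s : 'S_(m + n)) (-1) ^+ s *
    \det (\matrix_(i, j) N (s (lshift n i)) (lshift n j)) *
    \det (\matrix_(i, j) N (s (rshift m i)) (rshift m j)) = c * \det N.
Proof.
(* The weight [w r] is 1 if [r] preserves the two blocks of indices and 0 otherwise, so the constant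
   counts the block-preserving permutations. *)
pose same (i j : 'I_(m + n)) : bool := (i < m)%N == (j < m)%N.
pose w (r : 'S_(m + n)) : R := (\prod_i same i (r i))%:R.
exists (\sum_r w r) => N.
(* The product is the determinant of a block diagonal matrix, in whose Leibniz expansion only the
   block-preserving [r] survive. *)
have blockE (s : 'S_(m + n)) :
    \det (\matrix_(i, j) N (s (lshift n i)) (lshift n j)) *
    \det (\matrix_(i, j) N (s (rshift m i)) (rshift m j)) =
    \sum_r w r * ((-1) ^+ r * \prod_i N (s i) (r i)).
  rewrite -(det_ublock _ 0); apply: eq_bigr => r _.
  rewrite mulrCA; congr (_ * _); rewrite mulr_natl -prodrMn.
  apply: eq_bigr => i _; rewrite mxE /same.
  case: split_ordP => k ->; rewrite mxE; case: split_ordP => l ->;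
    rewrite mxE /= ?ltn_ord ?ltnNge ?leq_addr //= ?mulr0n ?mulr1n //.
under eq_bigr do rewrite -mulrA blockE mulr_sumr.
rewrite exchange_big mulr_suml; apply: eq_bigr => r _ /=.
under eq_bigr do rewrite mulrCA.
rewrite -mulr_sumr; congr (_ * _).
transitivity ((-1) ^+ r * \det (col_perm r N)).
  rewrite -det_tr /determinant mulr_sumr; apply: eq_bigr => s _.
  rewrite mulrCA; congr (_ * (_ * _)).
  by apply: eq_bigr => i _; rewrite !mxE.
by rewrite col_permE det_mulmx det_perm odd_permV mulrCA -signr_addb addbb mulr1.
Qed.

(** An alternating trilinear map is determined by its value on three spanning vectors. The predicate
    [T] restricts the axioms to tangent vectors, where alone forms are controlled. *)
Lemma alternating3_det (R : comNzRingType) (V : lmodType R) (T : V -> Prop)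
    (F : V -> V -> V -> R) :
    T 0 -> (forall u v, T u -> T v -> T (u + v)) ->
    (forall k u, T u -> T (k *: u)) ->
    (forall k a a' b c, T a -> T a' -> T b -> T c ->
      F (k *: a + a') b c = k * F a b c + F a' b c) ->
    (forall k a b b' c, T a -> T b -> T b' -> T c ->
      F a (k *: b + b') c = k * F a b c + F a b' c) ->
    (forall k a b c c', T a -> T b -> T c -> T c' ->
      F a b (k *: c + c') = k * F a b c + F a b c') ->
    (forall a c, T a -> T c -> F a a c = 0) ->
    (forall a b, T a -> T b -> F a b b = 0) ->
    (forall a b, T a -> T b -> F a b a = 0) ->
  forall (e : 'I_3 -> V) (x : 'I_3 -> 'I_3 -> R), (forall i, T (e i)) ->
  let o1 : 'I_3 := Ordinal (isT : (1 < 3)%N) in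
  let u i := \sum_j x i j *: e j in
  F (u ord0) (u o1) (u ord_max) = F (e ord0) (e o1) (e ord_max) * det3 x.
Proof.
move=> T0 TD TZ F1 F2 F3 A12 A23 A13 e x Te o1 u.
have F10 b c : T b -> T c -> F 0 b c = 0.
  by move=> Tb Tc; have := F1 1 0 0 b c T0 T0 Tb Tc;
    rewrite scale1r addr0 mul1r => /eqP; rewrite -[X in X == _]addr0 => /eqP/addrI.
have F20 a c : T a -> T c -> F a 0 c = 0.
  by move=> Ta Tc; have := F2 1 a 0 0 c Ta T0 T0 Tc;
    rewrite scale1r addr0 mul1r => /eqP; rewrite -[X in X == _]addr0 => /eqP/addrI.
have F30 a b : T a -> T b -> F a b 0 = 0.
  by move=> Ta Tb; have := F3 1 a b 0 0 Ta Tb T0 T0;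
    rewrite scale1r addr0 mul1r => /eqP; rewrite -[X in X == _]addr0 => /eqP/addrI.
have uE i : u i = x i ord0 *: e ord0 + (x i o1 *: e o1 + (x i ord_max *: e ord_max + 0)).
  rewrite /u !big_ord_recl big_ord0.
  by congr (_ + (_ *: e _ + (_ *: e _ + 0))); try congr (x i _); apply: val_inj.
have TZD k v w : T v -> T w -> T (k *: v + w) by move=> Tv Tw; apply: TD => //; apply: TZ.
have Tl y z : T (y *: e o1 + (z *: e ord_max + 0)) by apply: (TZD) => //; apply: TZD.
have Tl1 z : T (z *: e ord_max + 0) by apply: TZD.
have L1 y0 y1 y2 b c : T b -> T c ->
    F (y0 *: e ord0 + (y1 *: e o1 + (y2 *: e ord_max + 0))) b c =
    y0 * F (e ord0) b c + (y1 * F (e o1) b c + y2 * F (e ord_max) b c).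
  by move=> Tb Tc; rewrite !F1 // F10 // addr0.
have L2 y0 y1 y2 a c : T a -> T c ->
    F a (y0 *: e ord0 + (y1 *: e o1 + (y2 *: e ord_max + 0))) c =
    y0 * F a (e ord0) c + (y1 * F a (e o1) c + y2 * F a (e ord_max) c).
  by move=> Ta Tc; rewrite !F2 // F20 // addr0.
have L3 y0 y1 y2 a b : T a -> T b ->
    F a b (y0 *: e ord0 + (y1 *: e o1 + (y2 *: e ord_max + 0))) =
    y0 * F a b (e ord0) + (y1 * F a b (e o1) + y2 * F a b (e ord_max)).
  by move=> Ta Tb; rewrite !F3 // F30 // addr0.
(* Antisymmetry by polarization: expand [F] at the repeated argument [a + b]. *)
have S12 a b c : T a -> T b -> T c -> F b a c = - F a b c.
  move=> Ta Tb Tc; apply/eqP; rewrite -addr_eq0; apply/eqP.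
  have Tab : T (1 *: a + b) by apply: TZD.
  have := A12 _ _ Tab Tc; rewrite F1 // !F2 // !A12 // !mul1r addr0 add0r.
  by rewrite addrC.
have S23 a b c : T a -> T b -> T c -> F a c b = - F a b c.
  move=> Ta Tb Tc; apply/eqP; rewrite -addr_eq0; apply/eqP.
  have Tbc : T (1 *: b + c) by apply: TZD.
  have := A23 _ _ Ta Tbc; rewrite F2 // !F3 // !A23 // !mul1r addr0 add0r.
  by rewrite addrC.
have Tu y0 y1 y2 : T (y0 *: e ord0 + (y1 *: e o1 + (y2 *: e ord_max + 0))).
  exact: TZD.
rewrite !uE L1 // !L2 // !L3 // !A12 // !A23 // !A13 //.
have E0 := Te ord0; have E1 := Te o1; have E2 := Te ord_max.
rewrite (S12 _ _ _ E0 E1 E2) (S23 _ _ _ E0 E1 E2).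
rewrite (S12 _ _ _ E0 E2 E1) (S23 _ _ _ E1 E0 E2) (S12 _ _ _ E0 E1 E2).
rewrite (S23 _ _ _ E2 E0 E1) (S12 _ _ _ E0 E2 E1) (S23 _ _ _ E0 E1 E2).
by rewrite /det3 -/o1; ring.
Qed.

End Determinants.

Section VolumeForms.
Context (R : realType).
Local Notation M2C := ('M[R]_2 * 'M[R]_2)%type.
Local Notation G := (SU2_embedded R).
Local Notation GG := (SU2_square R).
Implicit Types (p q : SU2 R) (X v : M2C).

Definition qcoord X (j : 'I_3) : R :=
  match val j with 0 => X.2 ord0 ord0 | 1 => X.1 ord0 ord_max | _ => X.2 ord0 ord_max end.

Definition qbasis (j : 'I_3) : M2C :=
  quat 0 (j == 0 :> nat)%:R (j == 1 :> nat)%:R (j == 2 :> nat)%:R.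

Lemma qcoordD X Y j : qcoord (X + Y) j = qcoord X j + qcoord Y j.
Proof. by case: j => [[|[|j]] ?]; rewrite /qcoord /= mxE. Qed.

Lemma qcoordZ k X j : qcoord (k *: X) j = k * qcoord X j.
Proof. by case: j => [[|[|j]] ?]; rewrite /qcoord /= mxE. Qed.

Lemma qcoord_sum (I : finType) (F : I -> M2C) j :
  qcoord (\sum_i F i) j = \sum_i qcoord (F i) j.
Proof.
apply: (big_morph (qcoord ^~ j)) => [X Y|]; first exact: qcoordD.
by rewrite -(scale0r (0 : M2C)) qcoordZ mul0r.
Qed.

Lemma tangent_qbasis j : tangent (1%g : G) (qbasis j : ambient G).
Proof. by apply/tangent1P; exists (j == 0 :> nat)%:R, (j == 1 :> nat)%:R, (j == 2 :> nat)%:R. Qed.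

Lemma tangent1_sum v : tangent (1%g : G) (v : ambient G) ->
  v = \sum_j qcoord v j *: qbasis j.
Proof.
move=> /tangent1P[x [y [z ->]]]; rewrite !big_ord_recl big_ord0 addr0 /qbasis /=.
rewrite !quatZ !quatD /qcoord /= !mxE /=.
by rewrite !mulr0 !mulr1 !addr0 !add0r.
Qed.

Section Nu.
Variable nu : diff_form G 3.
Hypothesis nu_form : is_form nu.
Hypothesis nu_biinv : forall a : SU2 R,
  form_eq (pullback (lmul a) nu) nu /\ form_eq (pullback (rmul a) nu) nu.

Lemma nu_lmul a (p : G) (v : 'I_3 -> ambient G) : tangent_frame p v ->
  nu ((a * p)%g : G) (fun i => mxc_mul (su2_coord a) (v i)) = nu p v.
Proof.
move=> tv; have [/(_ p v tv) <- _] := nu_biinv a; congr (nu _ _).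
by apply/funext => i; rewrite (differentialE (@curve_diff_lmul R a p) (tv i)).
Qed.

Lemma nu_rmul a (p : G) (v : 'I_3 -> ambient G) : tangent_frame p v ->
  nu ((p * a)%g : G) (fun i => mxc_mul (v i) (su2_coord a)) = nu p v.
Proof.
move=> tv; have [_ /(_ p v tv) <-] := nu_biinv a; congr (nu _ _).
by apply/funext => i; rewrite (differentialE (@curve_diff_rmul R a p) (tv i)).
Qed.

(** Left translation to the identity, followed by the coordinates along i, j, k. *)
Definition trivialize p X : 'rV[R]_3 :=
  \row_j qcoord (mxc_mul (su2_coord p^-1%g) X) j.

Let frame (a b c : ambient G) (i : 'I_3) : ambient G :=
  match val i with 0 => a | 1 => b | _ => c end.

Lemma nu1_det (v : 'I_3 -> ambient G) : tangent_frame (1%g : G) v ->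
  nu (1%g : G) v =
  nu (1%g : G) qbasis * \det (\matrix_(i, j) qcoord (v i) j).
Proof.
move=> tv; pose o1 : 'I_3 := Ordinal (isT : (1 < 3)%N).
have [lin alt] := nu_form.
have frameE (w : 'I_3 -> ambient G) : w = frame (w ord0) (w o1) (w ord_max).
  by apply/funext => -[[|[|[|j]]] lj] //; rewrite /frame /=; congr w; apply: val_inj.
have tf a b c : tangent (1%g : G) a -> tangent (1%g : G) b ->
    tangent (1%g : G) c -> tangent_frame (1%g : G) (frame a b c).
  by move=> ta tb tc [[|[|[|j]]] lj].
have f0 a b c x : ([eta frame a b c with ord0 |-> x] : 'I_3 -> ambient G) = frame x b c.
  by apply/funext => -[[|[|[|j]]] lj].
have f1 a b c x : ([eta frame a b c with o1 |-> x] : 'I_3 -> ambient G) = frame a x c.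
  by apply/funext => -[[|[|[|j]]] lj].
have f2 a b c x : ([eta frame a b c with ord_max |-> x] : 'I_3 -> ambient G) = frame a b x.
  by apply/funext => -[[|[|[|j]]] lj].
rewrite det_mx33 (frameE v) (frameE qbasis).
have -> : det3 (\matrix_(i, j) qcoord (frame (v ord0) (v o1) (v ord_max) i) j) =
    det3 (fun i => qcoord (v i)).
  by rewrite -frameE /det3 !mxE.
rewrite [v ord0](tangent1_sum (tv _)) [v o1](tangent1_sum (tv _)).
rewrite [v ord_max](tangent1_sum (tv _)).
apply: (@alternating3_det R _ (tangent (1%g : G))
  (fun a b c => nu (1%g : G) (frame a b c)) (tangent0 _) (@tangentD _ _)
  (@tangentZ _ _)) => //.
- move=> k a a' b c ta ta' tb tc; have := lin 1%g _ ord0 k _ _ (tf a b c ta tb tc) ta ta'.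
  by rewrite !f0.
- move=> k a b b' c ta tb tb' tc; have := lin 1%g _ o1 k _ _ (tf a b c ta tb tc) tb tb'.
  by rewrite !f1.
- move=> k a b c c' ta tb tc tc'; have := lin 1%g _ ord_max k _ _ (tf a b c ta tb tc) tc tc'.
  by rewrite !f2.
- by move=> a c ta tc; apply: (alt _ _ ord0 o1 (tf a a c ta ta tc)).
- by move=> a b ta tb; apply: (alt _ _ o1 ord_max (tf a b b ta tb tb)).
- by move=> a b ta tb; apply: (alt _ _ ord0 ord_max (tf a b a ta tb ta)).
- exact: tangent_qbasis.
Qed.

Lemma tangent_trivialized (p : G) (v : ambient G) : tangent p v ->
  tangent (1%g : G) (mxc_mul (su2_coord p^-1%g) v : ambient G).
Proof.
move=> tv; have := curve_diff_tangent (@curve_diff_lmul R p^-1%g p) tv.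
by rewrite /lmul mulVg.
Qed.

Lemma nu_det (p : G) (v : 'I_3 -> ambient G) : tangent_frame p v ->
  nu p v = nu (1%g : G) qbasis * \det (\matrix_(i, j) trivialize p (v i) 0 j).
Proof.
move=> tv; pose w i : ambient G := mxc_mul (su2_coord p^-1%g) (v i).
have wE : nu (1%g : G) w = nu p v.
  by have := nu_lmul p^-1%g tv; rewrite mulVg.
rewrite -wE (nu1_det (v := w)); last by move=> i; apply: tangent_trivialized.
by congr (_ * \det _); apply/matrixP => i j; rewrite !mxE.
Qed.

(** Write the image vectors as [- (p^-1 v) p^-1]. Right invariance removes the last factor, left
    invariance the first, and the sign of three vectors contributes (-1)^3. *)
Lemma nu_inv (p : G) (v : 'I_3 -> ambient G) : tangent_frame p v ->
  nu (p^-1%g : G) (fun i => mxc_adj (v i)) = - nu p v.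
Proof.
move=> tv; pose w i : ambient G := mxc_mul (su2_coord p^-1%g) (v i).
have tw : tangent_frame (1%g : G) w by move=> i; apply: tangent_trivialized.
have wE : nu (1%g : G) w = nu p v.
  by have := nu_lmul p^-1%g tv; rewrite mulVg.
have tw' : tangent_frame (1%g : G) (fun i => -1 *: w i) by move=> i; apply: tangentZ.
have -> : (fun i => mxc_adj (v i)) =
    (fun i => mxc_mul (-1 *: w i) (su2_coord p^-1%g)).
  by apply/funext => i; rewrite (mxc_adj_tangent (tv i)) scaleN1r.
transitivity (nu (1%g : G) (fun i => -1 *: w i)).
  by have := nu_rmul p^-1%g tw'; rewrite mul1g.
rewrite -wE (nu1_det tw) (nu1_det tw').
rewrite -mulrN; congr (_ * _).
have -> : \matrix_(i, j) qcoord (-1 *: w i) j = -1 *: \matrix_(i, j) qcoord (w i) j.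
  by apply/matrixP => i j; rewrite !mxE qcoordZ.
by rewrite detZ -signr_odd /= expr1 mulN1r.
Qed.

(* The rows are the coordinates of the vectors of the frame in the left
   trivialization of the tangent bundle of the square. *)
Definition frame_mx (p : GG) (v : 'I_(3 + 3) -> ambient GG) : 'M[R]_(3 + 3) :=
  row_mx (\matrix_(i, j) trivialize p.1 (v i).1 0 j)
         (\matrix_(i, j) trivialize p.2 (v i).2 0 j).

Lemma OmegaE (p : GG) (v : 'I_(3 + 3) -> ambient GG) : tangent_frame p v ->
  Omega nu p v = ((3`!)%:R * (3`!)%:R)^-1 *
    \sum_(s : 'S_(3 + 3)) (-1) ^+ s *
      nu p.1 (fun i => (v (s (lshift 3 i))).1) *
      nu p.2 (fun i => (v (s (rshift 3 i))).2).
Proof.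
move=> tv; rewrite /Omega /wedge_form; congr (_ * _); apply: eq_bigr => s _.
congr (_ * nu _ _ * nu _ _); apply/funext => i.
  by rewrite (differentialE (@curve_diff_fst R p) (tv _)).
by rewrite (differentialE (@curve_diff_snd R p) (tv _)).
Qed.

(** By [nu_det] each term of the wedge is a product of two block determinants of the row-permuted
    frame matrix, and [sum_perm_det_blocks] sums these products. *)
Lemma Omega_det : exists C : R, forall (p : GG) (v : 'I_(3 + 3) -> ambient GG),
  tangent_frame p v -> Omega nu p v = C * \det (frame_mx p v).
Proof.
have [c cE] := sum_perm_det_blocks R 3 3.
exists (((3`!)%:R * (3`!)%:R)^-1 * (nu (1%g : G) qbasis ^+ 2 * c)) => p v tv.
rewrite OmegaE // -!mulrA; congr (_ * _); rewrite mulrA -cE mulr_sumr.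
apply: eq_bigr => s _.
have t1 : tangent_frame (p.1 : G) (fun i => (v (s (lshift 3 i))).1).
  by move=> i; apply: (curve_diff_tangent (@curve_diff_fst R p) (tv _)).
have t2 : tangent_frame (p.2 : G) (fun i => (v (s (rshift 3 i))).2).
  by move=> i; apply: (curve_diff_tangent (@curve_diff_snd R p) (tv _)).
rewrite (nu_det t1) (nu_det t2).
have -> : \matrix_(i, j) frame_mx p v (s (lshift 3 i)) (lshift 3 j) =
    \matrix_(i, j) trivialize p.1 (v (s (lshift 3 i))).1 0 j :> 'M[R]_3.
  by apply/matrixP => i j; rewrite mxE row_mxEl mxE mxE.
have -> : \matrix_(i, j) frame_mx p v (s (rshift 3 i)) (rshift 3 j) =
    \matrix_(i, j) trivialize p.2 (v (s (rshift 3 i))).2 0 j :> 'M[R]_3.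
  by apply/matrixP => i j; rewrite mxE row_mxEr mxE mxE.
move: (nu _ qbasis) (\det _) (\det _) ((-1) ^+ s) => k d1 d2 e.
by ring.
Qed.

Lemma tangent_frame_diff (M N : embedded R) k (f : M -> N) D (p : M)
    (v : 'I_k -> ambient M) :
  curve_diff f p D -> tangent_frame p v -> tangent_frame (f p) (fun i => D (v i)).
Proof. by move=> fD tv i; apply: (curve_diff_tangent fD). Qed.

Lemma pullbackE (M N : embedded R) k (f : M -> N) D (p : M) (a : diff_form N k)
    (v : 'I_k -> ambient M) :
  curve_diff f p D -> tangent_frame p v ->
  pullback f a p v = a (f p) (fun i => D (v i)).
Proof.
move=> fD tv; rewrite /pullback; congr (a _ _); apply/funext => i.
by rewrite (differentialE fD (tv i)).
Qed.

Lemma pullback_inv_map :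
  form_eq (pullback (@inv_map R) (Omega nu)) (scale_form (-1) (Omega nu)).
Proof.
move=> p v tv; have fD := @curve_diff_inv R p.
rewrite (pullbackE _ fD tv) OmegaE; last exact: tangent_frame_diff fD tv.
rewrite /scale_form OmegaE // mulrCA; congr (_ * _); rewrite mulr_sumr.
apply: eq_bigr => s _.
have t1 : tangent_frame (p.1 : G) (fun i => (v (s (lshift 3 i))).1).
  by move=> i; apply: (curve_diff_tangent (@curve_diff_fst R p) (tv _)).
transitivity ((-1) ^+ s * - nu p.1 (fun i => (v (s (lshift 3 i))).1) *
    nu p.2 (fun i => (v (s (rshift 3 i))).2)).
  by congr (_ * _ * _); apply: nu_inv t1.
by rewrite mulrN mulNr mulN1r.
Qed.

Lemma pullback_swap_map :
  form_eq (pullback (@swap_map R) (Omega nu)) (scale_form (-1) (Omega nu)).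
Proof.
move=> p v tv; have fD := @curve_diff_swap R p; have [C CE] := Omega_det.
rewrite (pullbackE _ fD tv) /scale_form !CE //; last exact: tangent_frame_diff fD tv.
rewrite mulrCA; congr (_ * _).
(* The product [U *m L *m U] exchanges the blocks up to a sign, which [D] corrects. The first three
   have determinant 1, and [D] has determinant (-1)^3. *)
pose U : 'M[R]_(3 + 3) := block_mx 1%:M 1%:M 0 1%:M.
pose L : 'M[R]_(3 + 3) := block_mx 1%:M 0 (- 1%:M) 1%:M.
pose D : 'M[R]_(3 + 3) := block_mx (- 1%:M) 0 0 1%:M.
have -> : frame_mx (swap_map p) (fun i => ((v i).2, (v i).1)) =
    frame_mx p v *m (U *m L *m U *m D).
  rewrite /frame_mx /U /L /D !mulmx_block mul_row_block.
  rewrite !(mul1mx, mulmx1, mul0mx, mulmx0, mulNmx, mulmxN) /=.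
  by rewrite !(addr0, add0r, subrr, addNr, opprK, mul0mx, mulmx0, mulmx1, mulmxN, oppr0).
rewrite !det_mulmx /U /L /D !det_ublock det_lblock !det1 -scaleN1r detZ det1.
by rewrite -signr_odd /=; ring.
Qed.

Lemma pullback_mul_map :
  form_eq (pullback (@mul_map R) (Omega nu)) (Omega nu).
Proof.
move=> p v tv; have fD := @curve_diff_mul R p; have [C CE] := Omega_det.
rewrite (pullbackE _ fD tv) !CE //; last exact: tangent_frame_diff fD tv.
congr (_ * _); case: p v tv {fD} => s t v tv /=.
have tsV : su2_coord ((t * s)^-1%g : SU2 R) =
    mxc_mul (su2_coord s^-1%g) (su2_coord t^-1%g).
  by rewrite invgM su2_coordM.
(* The matrix of X -> s^-1 X s. The trivialized derivative of the product is (ts)^-1 (t' s + t s') =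
   s^-1 (t^-1 t') s + s^-1 s', which adds to the first block the second one times [Ad]. *)
pose Ad : 'M[R]_3 := \matrix_(k, j) qcoord
  (mxc_mul (mxc_mul (su2_coord s^-1%g) (qbasis k)) (su2_coord s)) j.
have -> : frame_mx (mul_map (s, t)) (fun i =>
    (mxc_mul (v i).2 (su2_coord s) + mxc_mul (su2_coord t) (v i).1, (v i).2)) =
    frame_mx (s, t) v *m block_mx 1%:M 0 Ad 1%:M.
  rewrite /frame_mx mul_row_block !mulmx1 !mulmx0 add0r; congr row_mx.
  apply/matrixP => i j; rewrite !mxE /= tsV.
  rewrite mxc_mulDr qcoordD addrC; congr (_ + _); last first.
    by rewrite -mxc_mulA [mxc_mul (su2_coord t^-1%g) _]mxc_mulA su2_coordVl mxc_mul1.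
  have tv2 : tangent (1%g : G) (mxc_mul (su2_coord t^-1%g) (v i).2 : ambient G).
    by apply: tangent_trivialized; apply: (curve_diff_tangent (@curve_diff_snd R (s, t)) (tv i)).
  rewrite mxc_mulA -(mxc_mulA (su2_coord s^-1%g)) (tangent1_sum tv2).
  have sumr (X : M2C) (F : 'I_3 -> M2C) :
      mxc_mul X (\sum_k F k) = \sum_k mxc_mul X (F k).
    by apply: (big_morph (mxc_mul X)) => [? ?|]; rewrite ?mxc_mulDr ?mxc_mul0.
  have suml (X : M2C) (F : 'I_3 -> M2C) :
      mxc_mul (\sum_k F k) X = \sum_k mxc_mul (F k) X.
    by apply: (big_morph (fun Y : M2C => mxc_mul Y X)) => [? ?|]; rewrite ?mxc_mulDl ?mxc_0mul.
  rewrite sumr suml qcoord_sum; apply: eq_bigr => k _.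
  by rewrite mxc_mulZr mxc_mulZl qcoordZ !mxE.
by rewrite det_mulmx det_lblock !det1 !mulr1.
Qed.

End Nu.

End VolumeForms.

(** * Nielsen maps *)

Section ExponentSums.

(** A cancelling pair of letters contributes opposite signs, so free reduction leaves exponent sums
    unchanged. *)
Lemma sum_mulw (j : 'I_2) (s t : seq letter) :
  \sum_(a <- mulw s t | a.1 == j) (-1) ^+ a.2 =
  \sum_(a <- s | a.1 == j) (-1) ^+ a.2 +
  \sum_(a <- t | a.1 == j) (-1) ^+ a.2 :> int.
Proof.
have -> : mulw s t = foldr cons_letter t s by [].
elim: s => [|a s IH]; first by rewrite big_nil add0r.
rewrite big_cons /= [RHS](_ : _ = (if a.1 == j then (-1) ^+ a.2 else 0) +
  \sum_(b <- foldr cons_letter t s | b.1 == j) (-1) ^+ b.2); last first.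
  by rewrite IH addrA; case: ifP; rewrite ?add0r.
case: (foldr cons_letter t s) => [|b w] /=.
  by rewrite big_cons; case: ifP; rewrite ?add0r // big_nil.
case: eqP => [->|_]; last by rewrite big_cons; case: ifP; rewrite ?add0r.
rewrite big_cons /linv /=; case: ifP; rewrite ?add0r //.
by case: a => i [] _ /=; rewrite addrA ?subrr ?addNr add0r.
Qed.

Lemma expsumM j u w : expsum j (u * w)%g = expsum j u + expsum j w.
Proof. exact: sum_mulw. Qed.

Lemma expsum1 j : expsum j 1%g = 0.
Proof. exact: big_nil. Qed.

Lemma expsumV j u : expsum j (u^-1)%g = - expsum j u.
Proof. by apply/eqP; rewrite -addr_eq0 -expsumM mulVg expsum1. Qed.

Lemma expsum_gen j i : expsum j (gen i) = (i == j)%:R.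
Proof. by rewrite /expsum /= big_mkcond big_seq1 /=; case: (i == j). Qed.

(** The determinant of the exponent matrix, stated for arbitrary pairs of words so that it can be
    followed along elementary moves. *)
Definition exp_det (u v : F2) : int :=
  expsum ord0 u * expsum ord_max v - expsum ord_max u * expsum ord0 v.

Lemma det_row_exponent (Phi : GroupAut F2) :
  \det (row_exponent Phi) = exp_det (Phi (gen ord0)) (Phi (gen ord_max)).
Proof.
rewrite (expand_det_row _ ord0) sum_ord2 /cofactor !det_mx11 !mxE /=.
have -> : lift ord0 ord0 = ord_max :> 'I_2 by apply: val_inj.
have -> : lift ord_max ord0 = ord0 :> 'I_2 by apply: val_inj.
by rewrite /exp_det expr0 expr1 mul1r mulN1r mulrN.
Qed.

End ExponentSums.

Section NielsenMaps.
Context (R : realType) (m : probability (SU2 R) R) (hm : is_haar m).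
Context (nu : diff_form (SU2_embedded R) 3).
Hypothesis nu_form : is_form nu.
Hypothesis nu_biinv : forall a : SU2 R,
  form_eq (pullback (lmul a) nu) nu /\ form_eq (pullback (rmul a) nu) nu.
Local Notation GG := (SU2_square R).

Definition word_map (u v : F2) (q : GG) : GG :=
  (subst q.1 q.2 u, subst q.1 q.2 v).

(** Differentiability along curves is carried along because the chain rule for pullbacks needs
    it. *)
Let good u v : Prop :=
  [/\ measure_preserving (m \x m)%E (word_map u v),
      curve_differentiable (word_map u v)
    & form_eq (pullback (word_map u v) (Omega nu))
              (scale_form (exp_det u v)%:~R (Omega nu))].

(** A move on the pair of words composes the word map with the elementary map on the outside;
    measures, differentials and determinants then multiply through. *)
Lemma good_comp (f : GG -> GG) (c : int) u v u' v' :
    measure_preserving (m \x m)%E f -> curve_differentiable f ->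
    form_eq (pullback f (Omega nu)) (scale_form c%:~R (Omega nu)) ->
    word_map u' v' = f \o word_map u v -> exp_det u' v' = c * exp_det u v ->
  good u v -> good u' v'.
Proof.
move=> mf df ff e de [mw dw fw]; rewrite /good e de; split.
- exact: measure_preserving_comp.
- exact: curve_differentiable_comp.
- move=> p w tw; rewrite (pullback_comp _ dw df tw) (pullback_form_eq dw ff tw).
  transitivity (c%:~R * pullback (word_map u v) (Omega nu) p w) => //.
  by rewrite (fw p w tw) /scale_form mulrA intrM.
Qed.

Lemma good_closed : nielsen_closed good.
Proof.
split=> u v.
- apply: (@good_comp (@swap_map R) (-1)).
  + exact: measure_preserving_swap.
  + by move=> p; eexists; apply: curve_diff_swap.
  + by move=> p w tw; rewrite (pullback_swap_map nu_form nu_biinv tw) /scale_form mulrN1z.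
  + by [].
  + by rewrite /exp_det; ring.
- apply: (@good_comp (@inv_map R) (-1)).
  + exact: measure_preserving_inv.
  + by move=> p; eexists; apply: curve_diff_inv.
  + by move=> p w tw; rewrite (pullback_inv_map nu_form nu_biinv tw) /scale_form mulrN1z.
  + by apply/funext => q; rewrite /word_map /inv_map /= substV.
  + by rewrite /exp_det !expsumV; ring.
- apply: (@good_comp (@mul_map R) 1).
  + exact: measure_preserving_mul.
  + by move=> p; eexists; apply: curve_diff_mul.
  + by move=> p w tw; rewrite (pullback_mul_map nu_form nu_biinv tw) /scale_form mul1r.
  + by apply/funext => q; rewrite /word_map /mul_map /= substM.
  + by rewrite /exp_det !expsumM; ring.
Qed.

Lemma good_gen : good (gen ord0) (gen ord_max).
Proof.
have idE : word_map (gen ord0) (gen ord_max) = id.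
  by apply/funext => -[q1 q2]; rewrite /word_map /= subst_gen0 subst_gen1.
have did (p : GG) : curve_diff (@id GG) p id by [].
rewrite /good idE; split.
- by split=> //; apply: measurable_id.
- by move=> p; exists id.
- move=> p w tw; rewrite (pullbackE _ (did p) tw) /scale_form /exp_det.
  by rewrite !expsum_gen /= mulr1 mul0r subr0 mul1r.
Qed.

Lemma nielsen_map_good (Phi : GroupAut F2) :
  [/\ measure_preserving (m \x m)%E (quaternionic_nielsen R Phi),
      curve_differentiable (quaternionic_nielsen R Phi)
    & form_eq (pullback (quaternionic_nielsen R Phi) (Omega nu))
              (scale_form (\det (row_exponent Phi))%:~R (Omega nu))].
Proof.
rewrite det_row_exponent.
exact: (nielsen_closed_F2_basis good_closed good_gen (F2_basis_aut Phi)).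
Qed.

End NielsenMaps.

Theorem theorem7p1 (R : realType)
    (m : probability (SU2 R) R) (hm : is_haar m)
    (nu : diff_form (SU2_embedded R) 3) (hnu : biinvariant_volume_form nu) :
  (forall Phi : GroupAut F2,
     measure_preserving (m \x m)%E (quaternionic_nielsen R Phi) /\
     (forall A : 'M[int]_2, A = row_exponent Phi ->
        form_eq (pullback (quaternionic_nielsen R Phi) (Omega nu))
                (scale_form (\det A)%:~R (Omega nu)))) /\
  (forall A : 'M[int]_2, \det A = 1 ->
     forall F : SU2_square R -> SU2_square R, quaternionic_lift A F ->
       [/\ orientation_preserving (Omega nu) F,
           form_eq (pullback F (Omega nu)) (Omega nu)
         & measure_preserving (m \x m)%E F]).
Proof.
have [g [_ _ nu_form _ nu_biinv]] := hnu.
have good := nielsen_map_good hm nu_form nu_biinv.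
split=> [Phi|A detA F [Phi [PhiA ->]]].
  by have [mPhi _ fPhi] := good Phi; split=> // A ->.
have [mPhi _ fPhi] := good Phi; rewrite PhiA detA in fPhi.
have fE : form_eq (pullback (quaternionic_nielsen R Phi) (Omega nu)) (Omega nu).
  by move=> p v tv; rewrite (fPhi p v tv) /scale_form mul1r.
by split=> // p v tv; rewrite (fE p v tv).
Qed.
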